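(* Let $A=(a_{ij})_{i,j\in I}$ be a generalized Cartan matrix and let $\mathcal{A}_0$ be a Poisson algebra without zerodivisors which is generated, as a Poisson algebra, by a set of nonzero elements $(\varphi_i)_{i\in I}$ such that $\mathrm{ad}_{\{\}}(\varphi_i)^{-a_{ij}+1}(\varphi_j)=0$ for all $i\neq j$. Let $\mathcal{A}=\mathcal{A}_0[\lambda]$ with $\lambda=(\lambda_i)_{i\in I}$, let $\mathcal{K}=Q(\mathcal{A})$ be its field of fractions, and for $i\in I$ let $s_i$ be the automorphism of $\mathcal{K}$ determined by $$s_i=\exp\Big(\frac{\lambda_i}{\varphi_i}\,\mathrm{ad}_{\{\}}(\varphi_i)\Big)\circ r_i ,$$ where $r_i$ is the $\mathcal{A}_0$-linear automorphism with $r_i(\lambda_j)=\lambda_j-a_{ji}\lambda_i$ $(j\in I)$. Then the automorphisms $s_i$ $(i\in I)$ give a realization of the Weyl group $W(A)$ as a group of canonical transformations of $\mathcal{K}$. Namely: (1) These automorphisms preserve the Poisson bracket of $\mathcal{K}$: for each $i\in I$, $s_i(\{\varphi,\psi\})=\{s_i(\varphi),s_i(\psi)\}$ for all $\varphi,\psi\in\mathcal{K}$. (2) They satisfy the fundamental relations for the generators of $W(A)$: $s_i^2=1$ and $(s_is_j)^{m_{ij}}=1$ $(i\ne j)$, where $m_{ij}=2,3,4,6$ or $\infty$ according as $a_{ij}a_{ji}=0,1,2,3$ or $\ge 4$.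
   Context: A generalized Cartan matrix (GCM) is an integer matrix $A=(a_{ij})_{i,j\in I}$ with $a_{jj}=2$, $a_{ij}\le 0$ for $i\ne j$, and $a_{ij}=0\iff a_{ji}=0$. If $I$ is infinite, $A$ is always assumed locally finite: for any $i\in I$, $a_{ij}=0$ except for finitely many $j$. The Weyl group $W(A)$ is the group with generators $r_i$ $(i\in I)$ and relations $r_i^2=1$, $(r_ir_j)^{m_{ij}}=1$ $(i\neq j)$, with $m_{ij}=2,3,4,6,\infty$ according as $a_{ij}a_{ji}=0,1,2,3,\ge4$ (no relation when $m_{ij}=\infty$). A Poisson algebra is a commutative $\mathbb{C}$-algebra with a skew-symmetric bilinear bracket $\{\,,\,\}$ which is a derivation in each argument and satisfies the Jacobi identity. $\mathrm{ad}_{\{\}}(f)=\{f,\cdot\}$. A canonical transformation is a homomorphism of Poisson algebras (an algebra homomorphism $T$ with $T(\{f,g\})=\{T(f),T(g)\}$). $\mathcal{A}_0[\lambda]$ is the polynomial ring over $\mathcal{A}_0$ in indeterminates $\lambda_i$ $(i\in I)$. The Poisson bracket of $\mathcal{A}_0$ extends uniquely to $\mathcal{K}$ so that $\{\lambda_i,\varphi\}=0$ for all $\varphi\in\mathcal{K}$. The operator $\mathrm{ad}_{\{\}}(\varphi_i)$ is locally nilpotent on $\mathcal{A}_0$, so for $\psi\in\mathcal{A}_0$ the formula gives the finite sum $s_i(\psi)=\sum_{k\ge0}\frac1{k!}\big(\frac{\lambda_i}{\varphi_i}\big)^k\mathrm{ad}_{\{\}}(\varphi_i)^k(\psi)$,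 and $s_i(\lambda_j)=\lambda_j-a_{ji}\lambda_i$. This defines a homomorphism $s_i:\mathcal{A}\to\mathcal{A}[\varphi_j^{-1}\,(j\in I)]$, which extends to an automorphism of $\mathcal{K}$ also denoted $s_i$. *)

(* Defs.v *)
From HB Require Import structures.
From mathcomp Require Import all_boot all_order all_algebra.
From mathcomp Require Import finmap.
From mathcomp Require Import boolp reals complex.
From mathcomp Require Import monalg.
From mathcomp Require Import zify.

Set Implicit Arguments.
Unset Strict Implicit.
Unset Printing Implicit Defensive.

Import GRing.Theory.
Local Open Scope fset_scope.
Local Open Scope ring_scope.

(* {malg R[{cmonom I}]} is the polynomial ring over R in commuting
   indeterminates indexed by an arbitrary I; multinomials does not provide its
   integral domain structure, which {fraction _} requires.                    *)
Section MonomialWeight.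
Variable I : choiceType.
Implicit Types (m n : {cmonom I}) (J : seq I) (s : seq {cmonom I}).

(* Reads the exponents of m along J as the digits of a number in base B: an
   additive function of m, injective on monomials with exponents below B. *)
Fixpoint mweightB (B : nat) J m : nat :=
  if J is j :: J' then (m j + B * mweightB B J' m)%N else 0%N.

Lemma mweightBM B J m n :
  mweightB B J (mmul m n) = (mweightB B J m + mweightB B J n)%N.
Proof. by elim: J => //= j J ->; rewrite cmM mulnDr addnACA. Qed.

Lemma mweightB_inj B J m n :
  (forall j, m j < B)%N -> (forall j, n j < B)%N ->
  mweightB B J m = mweightB B J n -> {in J, forall j, m j = n j}.
Proof.
move=> mB nB; elim: J => //= j J IH e.
have ej : m j = n j.
  have := congr1 (fun x => x %% B)%N e.
  rewrite ![(B * _)%N]mulnC ![(_ + _ * B)%N]addnC !modnMDl.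
  by rewrite !modn_small.
have B0 : (0 < B)%N by apply: leq_ltn_trans (mB j).
have /IH {}IH : mweightB B J m = mweightB B J n.
  by move: e; rewrite ej => /addnI /eqP; rewrite eqn_pmul2l // => /eqP.
by move=> k; rewrite inE => /orP[/eqP -> //|/IH].
Qed.

Lemma exists_mweight s : exists w : {cmonom I} -> nat,
  (forall m n, w (mmul m n) = w m + w n)%N /\ {in s &, injective w}.
Proof.
have [B sB] : exists B, {in s, forall m j, m j < B}%N.
  elim: s => [|m s [B IH]]; first by exists 0%N.
  exists (maxn B (mdeg m).+1) => n; rewrite inE => /orP[/eqP-> | /IH nB] j.
    rewrite leq_max ltnS; apply/orP; right.
    case: mdomP => // jm.
    by rewrite mdegE (big_fsetD1 j) //= leq_addr.
  by rewrite leq_max nB.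
have [J sJ] : exists J, {in s, forall m j, m j != 0%N -> j \in J}.
  elim: s {B sB} => [|m s [J IH]]; first by exists [::].
  exists (finsupp m ++ J) => n; rewrite inE => /orP[/eqP-> | ns] j nj;
    rewrite mem_cat; first by rewrite -cmE_neq0 nj.
  by rewrite (IH n ns j nj) orbT.
exists (mweightB B J); split; first exact: mweightBM.
move=> m n ms ns /mweightB_inj e; apply/eqP/cmP => j.
case: (boolP (j \in J)) => [|jJ]; first exact: e (sB _ ms) (sB _ ns) _.
have z k : k \in s -> k j = 0%N.
  by move=> ks; apply/eqP; apply: contraNT jJ; apply: sJ.
by rewrite !z.
Qed.

Lemma exists_max_in (w : {cmonom I} -> nat) s :
  s != [::] -> exists2 m, m \in s & {in s, forall n, w n <= w m}%N.
Proof.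
elim: s => // m [|m' s] IH _.
  by exists m; rewrite ?inE // => n; rewrite inE => /eqP->.
have [//|k ks kmax] := IH; case: (leqP (w m) (w k)) => h.
  exists k => [|n]; first by rewrite inE ks orbT.
  by rewrite inE => /orP[/eqP-> //|/kmax].
exists m => [|n]; first by rewrite inE eqxx.
by rewrite inE => /orP[/eqP-> //|/kmax h']; apply: leq_trans h' (ltnW h).
Qed.

End MonomialWeight.

Section MalgDomain.
Variables (I : choiceType) (R : idomainType).
Local Notation A := (malg {cmonom I} R).
Implicit Types f g : A.

Lemma malg_mulf_neq0 f g : f != 0 -> g != 0 -> f * g != 0.
Proof.
move=> f0 g0.
have [w [wM w_inj]] := exists_mweight (msupp f ++ msupp g).
have supp_max (h : A) : h != 0 ->
    exists2 m, m \in msupp h & {in msupp h, forall n, w n <= w m}%N.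
  move=> h0; apply: exists_max_in; apply: contra h0 => /eqP h0.
  rewrite -msupp_eq0; apply/eqP/fsetP => m; rewrite in_fset0.
  have : m \in enum_fset (msupp h) = false by rewrite h0.
  exact.
have [m mf mmax] := supp_max f f0; have [n ng nmax] := supp_max g g0.
suff E : (f * g)@_(mmul m n) = f@_m * g@_n.
  apply/eqP => fg0.
  move: E; rewrite fg0 mcoeff0 => /esym/eqP.
  by rewrite mulf_eq0 !mcoeff_eq0 mf ng.
have inner : \sum_(l <- msupp g `\ n)
    f@_m * g@_l *+ (mmul m l == mmul m n) = 0.
  rewrite big_seq big1 // => l; rewrite in_fsetD1 => /andP[ln lg].
  case: eqP => // e; have /eqP := congr1 w e; rewrite !wM eqn_add2l => /eqP we.
  have el : l = n by apply: w_inj we; rewrite mem_cat ?lg ?ng orbT.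
  by rewrite el eqxx in ln.
have outer : \sum_(k <- msupp f `\ m) \sum_(l <- msupp g)
    f@_k * g@_l *+ (mmul k l == mmul m n) = 0.
  rewrite big_seq big1 // => k; rewrite in_fsetD1 => /andP[km kf].
  rewrite big_seq big1 // => l lg; case: eqP => // e.
  have := congr1 w e; rewrite !wM => we.
  have wk : w k = w m by have := mmax k kf; have := nmax l lg; lia.
  have ek : k = m by apply: w_inj wk; rewrite mem_cat ?kf ?mf.
  by rewrite ek eqxx in km.
rewrite mcoeffMl (big_fsetD1 m) //= (big_fsetD1 n) //= eqxx mulr1n.
transitivity (f@_m * g@_n + 0 + 0); last by rewrite !addr0.
by congr (_ + _ + _); [exact: inner | exact: outer].
Qed.

(* Invertibility in A is decided classically. *)
Let has_inv f := exists g, g * f == 1.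

Definition malg_unit : pred A := fun f => `[< has_inv f >].

Definition malg_inv f : A :=
  if pselect (has_inv f) is left e then xchoose e else f.

Fact malg_mulVr : {in malg_unit, left_inverse 1 malg_inv *%R}.
Proof.
move=> f /asboolP uf; rewrite /malg_inv; case: pselect => // e.
by rewrite (eqP (xchooseP e)).
Qed.

Fact malg_unitPl f g : g * f = 1 -> malg_unit f.
Proof. by move=> gf; apply/asboolP; exists g; apply/eqP. Qed.

Fact malg_inv_out : {in [predC malg_unit], malg_inv =1 id}.
Proof.
move=> f; rewrite inE /= => /asboolPn uf.
by rewrite /malg_inv; case: pselect.
Qed.

Fact malg_mulf_eq0 f g : f * g = 0 -> (f == 0) || (g == 0).
Proof.
move=> /eqP; apply: contraTT; rewrite negb_or => /andP[f0 g0].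
exact: malg_mulf_neq0.
Qed.

HB.instance Definition _ := GRing.ComNzRing_hasMulInverse.Build A
  malg_mulVr malg_unitPl malg_inv_out.
HB.instance Definition _ := GRing.ComUnitRing_isIntegral.Build A malg_mulf_eq0.
End MalgDomain.

Section GeneralizedCartanMatrix.
Variable I : eqType.
Implicit Types (a : I -> I -> int) (i j : I) (u v : seq I).

Record is_GCM a : Prop := IsGCM {
  GCM_diag : forall i, a i i = 2;
  GCM_offdiag : forall i j, i != j -> a i j <= 0;
  GCM_zero : forall i j, a i j = 0 <-> a j i = 0;
  GCM_locally_finite : forall i, exists s : seq I,
    forall j, a i j != 0 -> j \in s
}.

(* None stands for m_ij = oo. The product is nonnegative for i != j in a
   generalized Cartan matrix, so the absolute value loses nothing.        *)
Definition coxeter_order a i j : option nat :=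
  match absz (a i j * a j i) with
  | 0 => Some 2
  | 1 => Some 3
  | 2 => Some 4
  | 3 => Some 6
  | _ => None
  end.

(* W(a) is presented as words in the r_i modulo the congruence generated by
   its relations; no letters r_i^-1 are needed since r_i^2 = 1.           *)
Inductive weyl_eq a : seq I -> seq I -> Prop :=
| weyl_refl u : weyl_eq a u u
| weyl_sym u v : weyl_eq a u v -> weyl_eq a v u
| weyl_trans u v w : weyl_eq a u v -> weyl_eq a v w -> weyl_eq a u w
| weyl_cat u u' v v' :
    weyl_eq a u u' -> weyl_eq a v v' -> weyl_eq a (u ++ v) (u' ++ v')
| weyl_square i : weyl_eq a [:: i; i] [::]
| weyl_coxeter i j m : i != j -> coxeter_order a i j = Some m ->
    weyl_eq a (flatten (nseq m [:: i; j])) [::].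

Definition word_act (T : Type) (s : I -> T -> T) u : T -> T :=
  foldr (fun i f => s i \o f) id u.

End GeneralizedCartanMatrix.

(* A commutative k-algebra is a commutative ring A with its structure map
   c : k -> A, a ring morphism.                                           *)
Section Poisson.
Variables (k : fieldType) (A : comNzRingType) (c : k -> A).
Implicit Types (br : A -> A -> A) (x y z : A).

Record is_poisson br : Prop := IsPoisson {
  poisson_skew : forall x y, br x y = - br y x;
  poisson_linearl : forall t x y z,
    br (c t * x + y) z = c t * br x z + br y z;
  poisson_linearr : forall t x y z,
    br z (c t * x + y) = c t * br z x + br z y;
  poisson_derl : forall x y z, br (x * y) z = x * br y z + br x z * y;
  poisson_derr : forall x y z, br z (x * y) = x * br z y + br z x * y;
  poisson_jacobi : forall x y z,
    br x (br y z) + br y (br z x) + br z (br x y) = 0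
}.

Inductive poisson_generated br (J : Type) (phi : J -> A) : A -> Prop :=
| pgen_gen i : poisson_generated br phi (phi i)
| pgen_const t : poisson_generated br phi (c t)
| pgen_add x y : poisson_generated br phi x -> poisson_generated br phi y ->
    poisson_generated br phi (x + y)
| pgen_mul x y : poisson_generated br phi x -> poisson_generated br phi y ->
    poisson_generated br phi (x * y)
| pgen_bracket x y :
    poisson_generated br phi x -> poisson_generated br phi y ->
    poisson_generated br phi (br x y).

Record canonical_transformation br (T : A -> A) : Prop := IsCanonical {
  canonical_ring : zmod_morphism T /\ monoid_morphism T;
  canonical_const : forall t, T (c t) = c t;
  canonical_bracket : forall x y, T (br x y) = br (T x) (T y)
}.

End Poisson.

Notation lambda_fractions A0 I := {fraction {malg A0[{cmonom I}]}}.

Section LambdaFractions.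
Variables (I : choiceType) (A0 : idomainType).
Local Notation K := (lambda_fractions A0 I).

Definition cst (x : A0) : K := tofrac x%:MP.

Definition lambda (i : I) : K := tofrac << ucm i >>.

Variables (k : fieldType) (c : k -> A0) (br : A0 -> A0 -> A0).

Record is_poisson_extension (brK : K -> K -> K) : Prop := IsPoissonExtension {
  extension_poisson : is_poisson (cst \o c) brK;
  extension_cst : forall x y, brK (cst x) (cst y) = cst (br x y);
  extension_lambda : forall i f, brK (lambda i) f = 0
}.

Variables (a : I -> I -> int) (phi : I -> A0).

(* s_i = exp ((lambda_i / phi_i) ad(phi_i)) \o r_i. The exponential is cut at
   any N with ad(phi_i)^N psi = 0, so its value does not depend on N.       *)
Record is_weyl_automorphism (i : I) (s : K -> K) : Prop :=
  IsWeylAutomorphism {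
  weyl_bijective : bijective s;
  weyl_cst : forall (psi : A0) (N : nat), iter N (br (phi i)) psi = 0 ->
    s (cst psi) = \sum_(n < N) (n`!%:R)^-1 *
      (lambda i / cst (phi i)) ^+ n * cst (iter n (br (phi i)) psi);
  weyl_lambda : forall j, s (lambda j) = lambda j - lambda i *~ a j i
}.

End LambdaFractions.

(* Main.v *)
Require Import Defs.
From HB Require Import structures.
From mathcomp Require Import all_boot all_order all_algebra.
From mathcomp Require Import finmap reals complex monalg.
From mathcomp Require Import ring zify.

Set Implicit Arguments.
Unset Strict Implicit.
Unset Printing Implicit Defensive.

Import GRing.Theory.
Local Open Scope ring_scope.

(** On A0 the reflection s_i is exp ((lambda_i / phi_i) ad phi_i), the time one
    flow of the Hamiltonian lambda_i log phi_i. It is canonical on A0 by the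
    Leibniz rule for the iterates of ad phi_i: the terms that come from
    bracketing with lambda_i / phi_i cancel (exp_canonical). Two derivations
    along s_i that agree on A0 and on the lambda's agree on K, which extends
    this to K (s_canonical). Since s_i fixes phi_i and negates lambda_i, its
    square on A0 is exp (- x ad phi_i) exp (x ad phi_i) = 1 (exp_involution).

    A Coxeter relation says that a word T = (s_i s_j)^m is the identity. Its
    action on the lambda's is the linear computation in the reflection
    representation. On A0, T is a product G of exponentials of x ad phi_i and
    x ad phi_j for various x in K, so it is governed by an element G of the
    unipotent group of the rank two nilpotent Lie algebra spanned by phi_i,
    phi_j and their brackets, of which the Serre relations leave at most 2, 3,
    4 or 6 in the types A1 x A1, A2, B2 and G2.

    That G = 1 is seen in a small faithful representation rho of the rank two
    semisimple Lie algebra. There is a lower triangular matrix F over K, with the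
    brackets of phi_i and phi_j below the diagonal and weights in the lambda's
    on it, such that s_i F = g^-1 F g for g the exponential of
    (lambda_i / phi_i) rho (e_i). Hence T F = G^-1 F G. As T fixes the
    lambda's, F and T F have the same diagonal, whose entries are distinct, and
    then a unipotent upper triangular G with F G = G (T F) is the identity
    (unitriangular_conjugator).

    To carry this from rho back to A0, where the same Lie algebra acts by ad,
    one differentiates with the Euler derivation D of K, the sum of
    lambda_i d/dlambda_i. The logarithmic derivative G^-1 D(G) is a vector of
    the Lie algebra over K given by one formula in both representations
    (log_derivative_step). It vanishes because rho is faithful, so D (T v) = 0
    for v in A0 (word_constant). Finally every s_i is the identity at
    lambda = 0, so T v - v is a function that vanishes at lambda = 0 and is
    killed by D, that is, homogeneous of degree 0: it is zero
    (separating_derivation). *)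

(** * Additive maps and derivations *)

Definition char0 (F : nzRingType) : Prop := forall n, n.+1%:R != 0 :> F.

Lemma char0_intr_eq0 (F : nzRingType) (n : int) : char0 F ->
  (n%:~R == 0 :> F) = (n == 0).
Proof.
move=> F0; case: n => [[|n]|n]; rewrite ?eqxx //= ?NegzE ?mulrNz ?oppr_eq0.
  exact: negbTE (F0 n).
exact: negbTE (F0 n).
Qed.

Section AdditiveMaps.
Variables (U W : zmodType) (f : U -> W).
Hypothesis fB : zmod_morphism f.

Lemma zmod0 : f 0 = 0.
Proof. by rewrite -[X in f X](subrr 0) fB subrr. Qed.

Lemma zmodN : {morph f : u / - u}.
Proof. by move=> u; rewrite -[- u]add0r fB zmod0 // add0r. Qed.

Lemma zmodD : {morph f : u v / u + v}.
Proof. by move=> u v; rewrite -{1}[v]opprK fB zmodN // opprK. Qed.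

Lemma zmod_sum (J : Type) (r : seq J) (P : pred J) (G : J -> U) :
  f (\sum_(j <- r | P j) G j) = \sum_(j <- r | P j) f (G j).
Proof. exact: (big_morph f zmodD zmod0). Qed.

Lemma zmodMn u n : f (u *+ n) = f u *+ n.
Proof. by elim: n => [|n IH]; rewrite ?mulr0n ?zmod0 // !mulrS zmodD // IH. Qed.

Lemma zmodMz u (n : int) : f (u *~ n) = f u *~ n.
Proof. by case: n => n; rewrite ?NegzE ?mulrNz ?zmodN // -!pmulrn zmodMn. Qed.
End AdditiveMaps.

Lemma zmod_iter (U : zmodType) (f : U -> U) n :
  zmod_morphism f -> zmod_morphism (iter n f).
Proof. by move=> fB; elim: n => [|n IH] u v //=; rewrite IH fB. Qed.

Definition derivation_along (R S : nzRingType) (h d : R -> S) : Prop :=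
  zmod_morphism d /\ forall x y, d (x * y) = d x * h y + h x * d y.

Section Derivation.
Variables (R S : nzRingType) (h d : R -> S).
Hypothesis dP : derivation_along h d.

Lemma derB x y : d (x - y) = d x - d y. Proof. exact: dP.1. Qed.
Lemma derM x y : d (x * y) = d x * h y + h x * d y. Proof. exact: dP.2. Qed.
Lemma der0 : d 0 = 0. Proof. exact: zmod0 dP.1. Qed.
Lemma derD x y : d (x + y) = d x + d y. Proof. exact: zmodD dP.1 _ _. Qed.
Lemma der1 : h 1 = 1 -> d 1 = 0.
Proof.
move=> h1; have := derM 1 1; rewrite h1 mulr1 mul1r mulr1 => /eqP.
by rewrite -{1}[d 1]addr0 (inj_eq (addrI _)) => /eqP ->.
Qed.
End Derivation.

Section FieldDerivation.
Variables (K : fieldType) (s : {rmorphism K -> K}) (d : K -> K).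
Hypothesis dP : derivation_along s d.

Lemma der_nat n : d n%:R = 0.
Proof. by rewrite (zmodMn dP.1) (der1 dP (rmorph1 s)) mul0rn. Qed.

Lemma derV x : d x^-1 = - (s x)^-2 * d x.
Proof.
have [->|x0] := eqVneq x 0; first by rewrite invr0 (der0 dP) mulr0.
have sx0 : s x != 0 by rewrite fmorph_eq0.
have := derM dP x x^-1; rewrite divff // (der1 dP (rmorph1 s)) fmorphV => /eqP.
rewrite eq_sym addrC addr_eq0 => /eqP e.
by apply: (mulfI sx0); rewrite e; field.
Qed.
End FieldDerivation.

Section QuotientRule.
Variables (F : fieldType) (x y x' y' dx dy dx' dy' : F).
Hypotheses (y0 : y != 0) (y'0 : y' != 0).

Lemma quotient_ruleB :
  ((dx * y' + x * dy' - (dx' * y + x' * dy)) * (y * y')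
     - (x * y' - x' * y) * (dy * y' + y * dy')) / (y * y') ^+ 2
  = (dx * y - x * dy) / y ^+ 2 - (dx' * y' - x' * dy') / y' ^+ 2.
Proof. by field; apply/andP. Qed.

Lemma quotient_ruleM :
  ((dx * x' + x * dx') * (y * y')
     - x * x' * (dy * y' + y * dy')) / (y * y') ^+ 2
  = (dx * y - x * dy) / y ^+ 2 * (x' / y')
    + x / y * ((dx' * y' - x' * dy') / y' ^+ 2).
Proof. by field; apply/andP. Qed.

Lemma subf_div : x / y - x' / y' = (x * y' - x' * y) / (y * y').
Proof. by field; apply/andP. Qed.
End QuotientRule.

Section Fractions.
Variable R : idomainType.
Local Notation Q := {fraction R}.
Local Notation fr := (@FracField.tofrac R).

Lemma fraction_repr (f : Q) : exists p q : R, q != 0 /\ f = fr p / fr q.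
Proof.
elim/quotW: f => x; exists x.1, x.2; split; first exact: denom_ratioP.
have d0 : fr x.2 != 0 by rewrite tofrac_eq0 denom_ratioP.
apply: (mulIf d0); rewrite divfK //.
unlock FracField.tofrac; rewrite -[LHS]FracField.pi_mul.
apply/eqP; rewrite FracField.equivf_def /FracField.mulf /=.
by rewrite !numden_Ratio ?mulf_neq0 ?oner_eq0 ?denom_ratioP // !mulr1 mulrC.
Qed.

Lemma fraction_eq p q p' q' : q != 0 -> q' != 0 ->
  fr p / fr q = fr p' / fr q' -> p * q' = p' * q.
Proof.
move=> q0 q'0 /eqP; rewrite eqr_div ?tofrac_eq0 // -!tofracM tofrac_eq.
by move=> /eqP.
Qed.

(** The quotient rule. It does not depend on the chosen fraction, as one sees
    by applying d to the equation p q' = p' q between two of them. *)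
Lemma fraction_derivation (d : R -> R) : derivation_along id d ->
  exists D : Q -> Q, derivation_along id D /\ forall x, D (fr x) = fr (d x).
Proof.
move=> dP.
have ex (f : Q) : exists g : Q, exists p q : R,
    [/\ q != 0, f = fr p / fr q & g = fr (d p * q - p * d q) / fr q ^+ 2].
  have [p [q [q0 ->]]] := fraction_repr f.
  by exists (fr (d p * q - p * d q) / fr q ^+ 2), p, q.
have ch (f : Q) := boolp.cid (ex f).
pose D f := projT1 (ch f).
have DE p q : q != 0 ->
    D (fr p / fr q) = fr (d p * q - p * d q) / fr q ^+ 2.
  move=> q0; rewrite /D; case: (ch _) => g /= [p' [q' [q'0 e ->]]].
  have pq := fraction_eq q0 q'0 e.
  have := congr1 d pq; rewrite !(derM dP) => dpq.
  have q1 : fr q != 0 by rewrite tofrac_eq0.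
  have q'1 : fr q' != 0 by rewrite tofrac_eq0.
  apply/eqP; rewrite eqr_div ?expf_neq0 // -!tofracXn -!tofracM tofrac_eq.
  have {}dpq : d p * q' = d p' * q + p' * d q - p * d q' by rewrite -dpq addrK.
  apply/eqP; symmetry.
  transitivity (d p * q' * (q * q') - p * q' * (d q * q')); first by ring.
  rewrite dpq.
  transitivity (q ^+ 2 * (d p' * q') - p * q' * (q * d q')
                + (p' * q - p * q') * (d q * q')); first by ring.
  by rewrite pq subrr mul0r addr0; ring.
exists D; split; last first.
  move=> x; rewrite -[fr x]divr1 -tofrac1 DE ?oner_eq0 //.
  by rewrite (der1 dP) // mulr1 mulr0 subr0 tofrac1 expr1n divr1.
split=> f g.
  have [p [q [q0 ->]]] := fraction_repr f.
  have [p' [q' [q'0 ->]]] := fraction_repr g.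
  have q1 : fr q != 0 by rewrite tofrac_eq0.
  have q'1 : fr q' != 0 by rewrite tofrac_eq0.
  rewrite subf_div // -!tofracM -tofracB !DE ?mulf_neq0 //.
  rewrite !(derB dP) !(derM dP) !(tofracB, tofracM, tofracD).
  exact: quotient_ruleB.
have [p [q [q0 ->]]] := fraction_repr f.
have [p' [q' [q'0 ->]]] := fraction_repr g.
have q1 : fr q != 0 by rewrite tofrac_eq0.
have q'1 : fr q' != 0 by rewrite tofrac_eq0.
rewrite mulf_div -!tofracM !DE ?mulf_neq0 // !(derM dP).
rewrite !(tofracB, tofracM, tofracD).
exact: quotient_ruleM.
Qed.
End Fractions.

(** * The Euler derivation of the polynomial ring *)

Section EulerDerivation.
Variables (I : choiceType) (R : idomainType).
Local Notation A := (malg {cmonom I} R).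
Implicit Types (f g p q : A) (m : {cmonom I}).

Definition euler f : A := [malg m in msupp f => f@_m *+ mdeg m].

Lemma euler_coeff f m : (euler f)@_m = f@_m *+ mdeg m.
Proof.
by rewrite mcoeffE; case: msuppP => // _; rewrite mul0rn.
Qed.

Lemma euler_supp f : (msupp (euler f) `<=` msupp f)%fset.
Proof.
apply/fsubsetP => m; rewrite -!mcoeff_neq0 euler_coeff; apply: contra.
by move=> /eqP ->; rewrite mul0rn.
Qed.

Lemma euler_derivation : derivation_along id euler.
Proof.
split=> f g.
  by apply/malgP => m; rewrite !(mcoeffB, euler_coeff) mulrnBl.
apply/malgP => m; rewrite mcoeffD euler_coeff.
(* The three products are expanded over the same supports. *)
have eMl := @mcoeffMlw _ _ _ _ (euler f) g m (euler_supp f) (fsubset_refl _).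
have eMr := @mcoeffMlw _ _ _ _ f (euler g) m (fsubset_refl _) (euler_supp g).
rewrite [X in X *+ _]mcoeffMl [X in _ = X + _]eMl [X in _ = _ + X]eMr.
rewrite -sumrMnl -big_split /=; apply: eq_bigr => k _.
rewrite -sumrMnl -big_split /=; apply: eq_bigr => l _.
rewrite !euler_coeff; case: eqP => [<-|]; last by rewrite !mulr0n mul0rn addr0.
by rewrite mdegM mulrnDr !mulr1n mulrnAl mulrnAr.
Qed.

Lemma eulerC x : euler x%:MP = 0.
Proof.
apply/malgP => m; rewrite euler_coeff mcoeff0 mcoeffC.
by case: eqP => [->|]; rewrite ?mdeg1 ?mulr0n ?mul0rn.
Qed.

(** In a factorization of m other than m * 1 the left factor has smaller
    degree. *)
Lemma lowest_coeffM f g m :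
  (forall k, (mdeg k < mdeg m)%N -> f@_k = 0) ->
  (f * g)@_m = f@_m * g@_mone.
Proof.
move=> f_low.
have lef : (msupp f `<=` m |` msupp f)%fset by rewrite fsubsetU1.
have leg : (msupp g `<=` mone |` msupp g)%fset by rewrite fsubsetU1.
rewrite (mcoeffMlw _ lef leg) (big_fsetD1 m) ?fset1U1 //=.
rewrite (big_fsetD1 mone) ?fset1U1 //= mulm1 eqxx mulr1n.
have term k l : ~~ ((k == m) && (l == mone)) ->
    f@_k * g@_l *+ (mmul k l == m) = 0.
  move=> kl_neq; have [kl|//] := eqVneq (mmul k l) m.
  suff -> : f@_k = 0 by rewrite mul0r mul0rn.
  apply: f_low; rewrite -kl mdegM -[ltnLHS]addn0 ltn_add2l lt0n mdeg_eq0.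
  apply: contra kl_neq => /eqP l1.
  by move: kl; rewrite l1 mulm1 => ->; rewrite !eqxx.
have inner : \sum_(l <- ((mone |` msupp g) `\ mone)%fset)
    f@_m * g@_l *+ (mmul m l == m) = 0.
  apply: big1_fset => l; rewrite in_fsetD1 => /andP[l1 _] _.
  by rewrite term // negb_and l1 orbT.
have outer : \sum_(k <- ((m |` msupp f) `\ m)%fset)
    \sum_(l <- (mone |` msupp g)%fset) f@_k * g@_l *+ (mmul k l == m) = 0.
  apply: big1_fset => k; rewrite in_fsetD1 => /andP[km _] _.
  by apply: big1_fset => l _ _; rewrite term // negb_and km.
by rewrite [X in _ + X + _]inner [X in _ + X]outer !addr0.
Qed.

(** Compare the terms of lowest degree n > 0 in p: the left-hand side
    contributes n times p times the constant term of q, the right-hand side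
    nothing, since euler q has no constant term. *)
Lemma euler_constant p q : char0 R ->
  p@_mone = 0 -> q@_mone != 0 -> euler p * q = p * euler q -> p = 0.
Proof.
move=> R0 p0 q0 e.
have lowest m : (0 < mdeg m)%N ->
    (forall k, (mdeg k < mdeg m)%N -> p@_k = 0) -> p@_m = 0.
  move=> m_gt0 p_low.
  have ep_low k : (mdeg k < mdeg m)%N -> (euler p)@_k = 0.
    by move=> /p_low; rewrite euler_coeff => ->; rewrite mul0rn.
  have := congr1 (mcoeff m) e.
  rewrite [in LHS](lowest_coeffM _ ep_low) [in RHS](lowest_coeffM _ p_low).
  rewrite !euler_coeff mdeg1 mulr0n mulr0 -mulr_natr => /eqP.
  rewrite !mulf_eq0 (negbTE q0) orbF -(prednK m_gt0) (negbTE (R0 _)) orbF.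
  by move=> /eqP.
clear e; apply/malgP => m; rewrite mcoeff0.
have [n] := ubnP (mdeg m); elim: n m => [//|n IH] m; rewrite ltnS => mn.
have [/eqP|m_gt0] := posnP (mdeg m); first by rewrite mdeg_eq0 => /eqP->.
by apply: lowest => // k km; apply: IH; apply: leq_trans mn.
Qed.
End EulerDerivation.

(** * The field K of rational functions in the lambda's *)

Section LambdaField.
Variables (I : choiceType) (A0 : idomainType).
Local Notation A := {malg A0[{cmonom I}]}.
Local Notation K := (lambda_fractions A0 I).
Local Notation fr := (@FracField.tofrac A).
Local Notation cst := (@cst I A0).
Local Notation lambda := (@lambda I A0).

Lemma cst_zmod : zmod_morphism cst.
Proof. by move=> x y; rewrite /cst /Defs.cst rmorphB tofracB. Qed.
Lemma cst_monoid : monoid_morphism cst.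
Proof.
split=> [|x y]; last by rewrite /cst /Defs.cst rmorphM tofracM.
exact: (tofrac1 A).
Qed.

HB.instance Definition _ :=
  GRing.isZmodMorphism.Build A0 K cst cst_zmod.
HB.instance Definition _ :=
  GRing.isMonoidMorphism.Build A0 K cst cst_monoid.

Lemma cst_eq0 x : (cst x == 0) = (x == 0).
Proof. by rewrite /cst /Defs.cst tofrac_eq0 monalgU_eq0. Qed.

Lemma monomialM (x y : A0) (k l : {cmonom I}) :
  << x *g k >> * << y *g l >> = << x * y *g mmul k l >> :> A.
Proof. exact: fgmulUU. Qed.

Lemma ucm_generated (P : A -> Prop) :
  (forall x, P x%:MP) -> (forall i, P << ucm i >>) ->
  (forall f g, P f -> P g -> P (f + g)) ->
  (forall f g, P f -> P g -> P (f * g)) -> forall f, P f.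
Proof.
move=> Pc Pu PD PM f; rewrite (monalgE f).
elim/big_rec: _ => [|m g _]; first by rewrite -malgC0E.
apply: (PD) => //.
have -> : << f@_m *g m >> = (f@_m)%:MP * << m >> :> A.
  by rewrite monomialM mulr1 mul1m.
apply: (PM) => //.
have [n] := ubnP (mdeg m); elim: n m => // n IH m; rewrite ltnS => mn.
have [/eqP|m0] := posnP (mdeg m).
  by rewrite mdeg_eq0 => /eqP ->; apply: (Pc 1).
have [i mi] : exists i, m i != 0%N.
  apply: boolp.contrapT => no_i; move: m0; rewrite lt0n mdeg_eq0 => /negP; apply.
  apply/cmP => i; rewrite cm1; apply/eqP; apply: boolp.contrapT => mi.
  by apply: no_i; exists i; apply/negP.
have em : m = mmul (ucm i) (divcm m (ucm i)).
  apply/eqP/cmP => j; rewrite cmM divcmE cmU.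
  by case: eqP => [<-|_]; rewrite ?subn0 // subnKC // lt0n.
have -> : << m >> = << ucm i >> * << divcm m (ucm i) >> :> A.
  by rewrite monomialM mulr1 -em.
apply: (PM) => //; apply: IH; apply: leq_trans mn.
by rewrite {2}em mdegM mdegU.
Qed.

Lemma field_generated (P : K -> Prop) :
  (forall x, P (cst x)) -> (forall i, P (lambda i)) ->
  (forall f g, P f -> P g -> P (f + g)) ->
  (forall f g, P f -> P g -> P (f * g)) ->
  (forall f, P f -> P f^-1) -> forall f, P f.
Proof.
move=> Pc Pl PD PM PV f; have [p [q [_ ->]]] := fraction_repr f.
have Pfr (g : A) : P (fr g).
  elim/ucm_generated: g => [x|i|g h Pg Ph|g h Pg Ph].
  - exact: (Pc).
  - exact: Pl.
  - by rewrite tofracD; apply: (PD).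
  - by rewrite tofracM; apply: (PM).
by apply: (PM); last apply: (PV).
Qed.

Lemma mcoeff_lin (f g : A) (p q : int) m :
  (f *~ p + g *~ q)@_m = f@_m *~ p + g@_m *~ q.
Proof.
have mz (h : A) n : (h *~ n)@_m = h@_m *~ n by exact: (raddfMz (mcoeff m)).
by rewrite mcoeffD !mz.
Qed.

Lemma mcoeff_ucm i j : (<< ucm i >> : A)@_(ucm j) = (i == j)%:R.
Proof.
etransitivity; first exact: mcoeffU; congr (_ *+ nat_of_bool _).
by apply/cmP/eqP => [/(_ i)|-> //]; rewrite !cmU eqxx eq_sym; case: eqP.
Qed.

Lemma lambda_free i j (p q : int) : char0 A0 ->
  i != j -> lambda i *~ p + lambda j *~ q = 0 -> p = 0 /\ q = 0.
Proof.
move=> A0_0 ij e.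
have {}e : (<< ucm i >> *~ p + << ucm j >> *~ q : A) = 0.
  apply/eqP; rewrite -tofrac_eq0; apply/eqP.
  by rewrite tofracD !raddfMz.
have coeff m x y : (<< ucm i >> : A)@_m = x -> (<< ucm j >> : A)@_m = y ->
    x *~ p + y *~ q = 0.
  by move=> <- <-; rewrite -mcoeff_lin e mcoeff0.
split; apply/eqP; rewrite -(char0_intr_eq0 _ A0_0); apply/eqP.
  have := coeff _ _ _ (mcoeff_ucm i i) (mcoeff_ucm j i).
  by rewrite eqxx eq_sym (negbTE ij) mul0rz addr0.
have := coeff _ _ _ (mcoeff_ucm i j) (mcoeff_ucm j j).
by rewrite eqxx (negbTE ij) mul0rz add0r.
Qed.

(** The maximal ideal of the local ring at the origin lambda = 0. *)
Definition vanishing (f : K) : Prop :=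
  exists p q : A, [/\ p@_mone = 0, q@_mone != 0 & f = fr p / fr q].

Lemma mcoeff1M (f g : A) : (f * g)@_mone = f@_mone * g@_mone.
Proof. by apply: lowest_coeffM => k; rewrite mdeg1. Qed.

Lemma mcoeff_unit_neq0 (q : A) : q@_mone != 0 -> q != 0.
Proof. by apply: contraNneq => ->; rewrite mcoeff0. Qed.

Lemma vanishing_frac (p q : A) : p@_mone = 0 -> q@_mone != 0 ->
  vanishing (fr p / fr q).
Proof. by exists p, q. Qed.

Lemma vanishing0 : vanishing 0.
Proof.
exists 0, 1; rewrite mcoeff0 mcoeff1 eqxx oner_eq0; split=> //.
by rewrite tofrac0 mul0r.
Qed.

Lemma vanishing_lambda i : vanishing (lambda i).
Proof.
exists << ucm i >>, 1; split.
- by etransitivity; [exact: mcoeffU | rewrite cm1_eq1].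
- by rewrite [X in X != _]mcoeff1 eqxx oner_eq0.
- by rewrite [X in _ / X](tofrac1 A) divr1.
Qed.

Lemma vanishingD f g : vanishing f -> vanishing g -> vanishing (f + g).
Proof.
move=> [p [q [p0 q0 ->]]] [p' [q' [p'0 q'0 ->]]].
rewrite addf_div ?tofrac_eq0 ?mcoeff_unit_neq0 // -!tofracM -tofracD.
apply: vanishing_frac; last by rewrite mcoeff1M mulf_neq0.
rewrite mcoeffD [X in X + _]mcoeff1M [X in _ + X]mcoeff1M.
by rewrite p0 p'0 !mul0r addr0.
Qed.

Lemma vanishingM f g : vanishing f -> vanishing g -> vanishing (f * g).
Proof.
move=> [p [q [p0 q0 ->]]] [p' [q' [p'0 q'0 ->]]].
rewrite mulf_div -!tofracM.
apply: vanishing_frac; last by rewrite mcoeff1M mulf_neq0.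
by rewrite mcoeff1M p0 mul0r.
Qed.

Lemma vanishing_cstM x f : vanishing f -> vanishing (cst x * f).
Proof.
move=> [p [q [p0 q0 ->]]]; rewrite /cst /Defs.cst mulrA -tofracM.
by apply: vanishing_frac => //; rewrite mcoeff1M p0 mulr0.
Qed.

Lemma vanishing_div f g x : x != 0 -> vanishing f -> vanishing (g - cst x) ->
  vanishing (f / g).
Proof.
move=> x0 [p [q [p0 q0 ->]]] [p' [q' [p'0 q'0 /eqP]]].
rewrite subr_eq => /eqP ->.
have q'1 : fr q' != 0 by rewrite tofrac_eq0 mcoeff_unit_neq0.
have -> : fr p' / fr q' + cst x = fr (p' + x%:MP * q') / fr q'.
  by rewrite tofracD tofracM mulrDl mulfK.
rewrite invf_div mulf_div -!tofracM; apply: vanishing_frac.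
  by rewrite mcoeff1M p0 mul0r.
rewrite mcoeff1M mulf_neq0 // mcoeffD p'0 add0r.
by rewrite [X in X != _]mcoeffCM mulf_neq0.
Qed.

(** A function killed by the Euler derivation is homogeneous of degree 0, hence
    constant along the lines through the origin and determined by its value
    there. *)
Lemma separating_derivation : char0 A0 ->
  exists D : K -> K, [/\ derivation_along id D, forall x, D (cst x) = 0
    & forall f, vanishing f -> D f = 0 -> f = 0].
Proof.
move=> A0_0; have dP := euler_derivation I A0.
have [D [DP DE]] := fraction_derivation dP.
exists D; split=> // [x|f].
  by rewrite /cst /Defs.cst DE eulerC tofrac0.
move=> [p [q [p0 q0 ->]]]; have q1 := mcoeff_unit_neq0 q0.
have fq1 : fr q != 0 by rewrite tofrac_eq0.
move=> /(congr1 ( *%R^~ (fr q))); rewrite mul0r => Df.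
have := derM DP (fr p / fr q) (fr q); rewrite divfK // Df add0r !DE.
move=> /(congr1 ( *%R^~ (fr q))); rewrite mulrAC divfK // -!tofracM.
move=> /eqP; rewrite tofrac_eq => /eqP /(euler_constant A0_0 p0 q0) ->.
by rewrite tofrac0 mul0r.
Qed.
End LambdaField.

(** * Divided powers *)

Lemma pascal_sum (V : zmodType) (f : nat -> nat -> V) n :
  \sum_(j < n.+2) f j (n.+1 - j)%N *+ 'C(n.+1, j)
  = \sum_(j < n.+1) (f j (n - j).+1 + f j.+1 (n - j)%N) *+ 'C(n, j).
Proof.
rewrite big_ord_recl subn0 bin0 mulr1n.
under eq_bigr => j _ do rewrite lift0 /= binS mulrnDr subSS.
under [RHS]eq_bigr => j _ do rewrite mulrnDl.
rewrite !big_split /= addrA; congr (_ + _).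
transitivity (\sum_(j < n.+2) f j (n.+1 - j)%N *+ 'C(n, j)).
  by rewrite [RHS]big_ord_recl subn0 bin0.
rewrite big_ord_recr /= bin_small // mulr0n addr0.
by apply: eq_bigr => j _; rewrite subSn // -ltnS.
Qed.

(** Both sides sum h over the rectangle below (p, q), on which j + m < M. *)
Lemma triangle_sum (V : zmodType) (h : nat -> nat -> V) p q M :
  (p + q <= M)%N ->
  (forall j m, (p <= j)%N || (q <= m)%N -> h j m = 0) ->
  \sum_(n < M) \sum_(j < n.+1) h j (n - j)%N = \sum_(j < p) \sum_(m < q) h j m.
Proof.
move=> pqM h0.
transitivity (\sum_(n < M) \sum_(j < M | (j < n.+1)%N) h j (n - j)%N).
  by apply: eq_bigr => n _; rewrite (big_ord_widen M (fun j => h j (n - j)%N)).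
rewrite (exchange_big_dep xpredT) //=.
have pM : (p <= M)%N by apply: leq_trans pqM; apply: leq_addr.
rewrite [RHS](big_ord_widen M (fun j => \sum_(m < q) h j m)) //.
rewrite [RHS]big_mkcond; apply: eq_bigr => j _.
rewrite -(big_mkord (fun n => j < n.+1)%N (fun n => h j (n - j)%N)).
case: ltnP => [jp | pj]; last first.
  by apply: big1 => n _; rewrite h0 // pj.
have qM : (q <= M - j)%N by lia.
transitivity (\sum_(j <= n < M) h j (n - j)%N).
  rewrite (@big_cat_nat _ _ _ j 0%N M) //=; last exact: ltnW.
  rewrite [X in X + _]big_nat_cond big_pred0 ?add0r.
    by rewrite big_nat_cond [RHS]big_nat_cond; apply: eq_bigl => n; lia.
  by move=> n; lia.
rewrite -{1}[val j]add0n big_addn.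
rewrite (@big_cat_nat _ _ _ q) //= [X in _ + X]big_nat_cond.
rewrite [X in _ + X]big1 ?addr0 => [|m]; last first.
  by rewrite andbT addnK => /andP[qm _]; rewrite h0 // qm orbT.
by rewrite big_mkord; apply: eq_bigr => m _; rewrite addnK.
Qed.

Section DividedPowers.
Variable F : fieldType.
Hypothesis F0 : char0 F.

Lemma nat_neq0 n : (0 < n)%N -> n%:R != 0 :> F.
Proof. by case: n => // n _; apply: F0. Qed.

Lemma fact_neq0 n : n`!%:R != 0 :> F.
Proof. exact/nat_neq0/fact_gt0. Qed.

Lemma binomial_divided n j : (j <= n)%N ->
  n`!%:R^-1 * 'C(n, j)%:R = j`!%:R^-1 * (n - j)`!%:R^-1 :> F.
Proof.
move=> jn; rewrite -[in LHS](bin_fact jn) !natrM.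
have := fact_neq0 j; have := fact_neq0 (n - j).
have : 'C(n, j)%:R != 0 :> F by rewrite nat_neq0 // bin_gt0.
by move=> a b c; field; rewrite a b c.
Qed.

(** For f j m = a_j b_m this is the Cauchy product of two exponential series,
    which end at p and q. *)
Lemma exponential_product (f : nat -> nat -> F) p q M :
  (p + q <= M)%N ->
  (forall j m, (p <= j)%N || (q <= m)%N -> f j m = 0) ->
  \sum_(n < M) n`!%:R^-1 * \sum_(j < n.+1) f j (n - j)%N *+ 'C(n, j)
  = \sum_(j < p) \sum_(m < q) j`!%:R^-1 * m`!%:R^-1 * f j m.
Proof.
move=> pqM f0.
rewrite -(triangle_sum (h := fun j m => j`!%:R^-1 * m`!%:R^-1 * f j m) pqM).
  apply: eq_bigr => n _; rewrite mulr_sumr; apply: eq_bigr => j _.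
  by rewrite -binomial_divided -1?ltnS // -mulrA mulr_natl.
by move=> j m /f0 ->; rewrite mulr0.
Qed.
End DividedPowers.

(** S (exp (x e) v) for e nilpotent at v. The cut-off M matters only through
    e^M v = 0; the linear form S lets v live in a module over which x is not
    a scalar. *)
Definition expS (F : fieldType) (V : zmodType) (S : V -> F) (e : V -> V)
    (x : F) (M : nat) (v : V) : F :=
  \sum_(n < M) n`!%:R^-1 * x ^+ n * S (iter n e v).

Section ExpSum.
Variables (F : fieldType) (V : zmodType) (S : V -> F) (e : V -> V) (x : F).
Hypotheses (S0 : S 0 = 0) (e0 : e 0 = 0).

Lemma iter_eq0 n m v : (n <= m)%N -> iter n e v = 0 -> iter m e v = 0.
Proof.
by move=> /subnK <- h; rewrite iterD h; elim: (m - n)%N => //= k ->.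
Qed.

Lemma expS_stable M M' v : iter M e v = 0 -> iter M' e v = 0 ->
  expS S e x M v = expS S e x M' v.
Proof.
wlog le : M M' / (M <= M')%N.
  by move=> w h h'; case/orP: (leq_total M M') => l; [|symmetry]; exact: w.
move=> h _; rewrite /expS.
rewrite (big_ord_widen M' (fun n => n`!%:R^-1 * x ^+ n * S (iter n e v))) //.
rewrite big_mkcond; apply: eq_bigr => n _; case: ltnP => // Mn.
by rewrite (iter_eq0 Mn h) S0 mulr0.
Qed.
End ExpSum.

Section DerivationExp.
Variables (F : fieldType) (D : F -> F).
Hypotheses (F0 : char0 F) (DP : derivation_along id D).

Lemma derX x n : D (x ^+ n) = n%:R * x ^+ n.-1 * D x.
Proof.
elim: n => [|n IH]; first by rewrite expr0 (der1 DP erefl) !mul0r.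
rewrite exprS (derM DP) IH /= -natr1.
by case: n {IH} => [|n] /=; rewrite ?expr0 ?exprS; ring.
Qed.

Lemma der_factV n : D n`!%:R^-1 = 0.
Proof. by rewrite (derV (s := idfun) DP) (der_nat (s := idfun) DP) mulr0. Qed.

(** The term n of the series differentiates to D x times term n - 1. *)
Lemma der_expS (V : zmodType) (S : V -> F) (e : V -> V) x M v :
  S 0 = 0 -> e 0 = 0 -> iter M e v = 0 ->
  D (expS S e x M v) = D x * expS S e x M (e v)
    + \sum_(n < M) n`!%:R^-1 * x ^+ n * D (S (iter n e v)).
Proof.
move=> S0 e0 Mv; rewrite /expS (zmod_sum DP.1).
under eq_bigr => n _ do rewrite (derM DP) (derM DP) der_factV mul0r add0r derX.
rewrite big_split /=; congr (_ + _).
case: M Mv => [|M] Mv; first by rewrite !big_ord0 mulr0.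
rewrite big_ord_recl mulr0n !mul0r mulr0 mul0r add0r.
rewrite [X in D x * X]big_ord_recr /= -iterSr Mv S0 mulr0 addr0.
rewrite mulr_sumr; apply: eq_bigr => n _.
rewrite -iterSr /bump add1n factS natrM /=.
have n1 : n.+1%:R != 0 :> F by [].
by field; rewrite fact_neq0 //= addrC natr1.
Qed.
End DerivationExp.

(** * Logarithmic derivative of a product of exponentials *)

Section LogDerivative.
Variables (F : fieldType) (D : F -> F).
Hypotheses (F0 : char0 F) (DP : derivation_along id D).

Variables (d : nat) (N : 'M[int]_d) (b : 'I_d).

Definition adjoint (y : 'I_d -> F) : 'I_d -> F :=
  fun g => \sum_k y k * (N k g)%:~R.

(** The coordinates of exp (- x ad e) y + D x * e, where y is a vector in the
    Lie algebra with basis indexed by 'I_d, e is the basis vector b, and N is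
    the matrix of - ad e. *)
Definition log_step (x : F) (y : 'I_d -> F) : 'I_d -> F :=
  fun g => \sum_(j < d) j`!%:R^-1 * x ^+ j * iter j adjoint y g
           + (if g == b then D x else 0).

Hypothesis N_upper : forall k g, N k g != 0 -> (k < g)%N.

Lemma adjoint_nilpotent y j : (d <= j)%N -> iter j adjoint y =1 fun=> 0.
Proof.
move=> dj; suff low n (g : 'I_d) : (g < n)%N -> iter n adjoint y g = 0.
  by move=> g; apply: low; apply: leq_trans dj.
elim: n g => [//|n IH] g gn /=; apply: big1 => k _.
have [->|/N_upper kg] := eqVneq (N k g) 0; first by rewrite mulr0.
by rewrite IH ?mul0r //; apply: leq_trans kg _.
Qed.

Variables (V : zmodType) (E : 'I_d -> V -> V) (S S' : V -> F) (x : F).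
Variable y : 'I_d -> F.
Hypotheses (S_add : zmod_morphism S) (E_add : forall k, zmod_morphism (E k)).
Hypothesis E_comm : forall k v,
  E k (E b v) = E b (E k v) + \sum_g E g v *~ N k g.
Hypothesis E_nil : forall v, exists n, iter n (E b) v = 0.
Hypothesis S'_exp : forall v n, iter n (E b) v = 0 ->
  S' v = expS S (E b) x n v.
Hypothesis D_S : forall v, D (S v) = \sum_k y k * S (E k v).

(** The vector z of the Lie algebra acts on v, then the form T is applied. *)
Let Theta z (T : V -> F) v := \sum_k z k * T (E k v).

Lemma Theta_comm z T v : zmod_morphism T ->
  Theta z T (E b v) = Theta z (T \o E b) v + Theta (adjoint z) T v.
Proof.
move=> TB; rewrite /Theta /adjoint.
under eq_bigr => k _ do
  rewrite E_comm (zmodD TB) mulrDr (zmod_sum TB) mulr_sumr.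
rewrite big_split /= exchange_big /=; congr (_ + _).
apply: eq_bigr => g _; rewrite mulr_suml; apply: eq_bigr => k _.
by rewrite (zmodMz TB) -mulrzr; ring.
Qed.

Lemma Theta_iter n v : Theta y S (iter n (E b) v)
  = \sum_(j < n.+1)
      Theta (iter j adjoint y) (S \o iter (n - j) (E b)) v *+ 'C(n, j).
Proof.
elim: n v => [|n IH] v; first by rewrite big_ord1.
rewrite iterSr IH.
rewrite (pascal_sum (fun j m => Theta (iter j adjoint y) (S \o iter m (E b)) v)).
apply: eq_bigr => j _; congr (_ *+ _); rewrite Theta_comm.
  by congr (_ + _); apply: eq_bigr => k _; rewrite /= -iterSr.
by move=> u w /=; rewrite (zmod_iter _ (E_add b)) S_add.
Qed.

(** Differentiating S (exp (x e) v): the derivative of S contributes y, which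
    is moved to the right past exp (x e), and that of x contributes e. *)
Lemma log_derivative_step v :
  D (S' v) = \sum_g log_step x y g * S' (E g v).
Proof.
have e0 := zmod0 (E_add b); have S0 := zmod0 S_add.
have [q qv qE] : exists2 q, iter q (E b) v = 0
    & forall g, iter q (E b) (E g v) = 0.
  have [q0 q0v] := E_nil v.
  have [f fE] := boolp.choice (fun g => E_nil (E g v)).
  exists (maxn q0 (\max_g f g)) => [|g]; first exact: iter_eq0 (leq_maxl _ _) q0v.
  apply: (iter_eq0 e0 _ (fE g)); apply: leq_trans (leq_maxr _ _).
  exact: leq_bigmax.
set M := (d + q)%N.
have Mv : iter M (E b) v = 0 by apply: (iter_eq0 e0 _ qv); rewrite /M; lia.
have MEv : iter M (E b) (E b v) = 0 by rewrite -iterSr iterS Mv.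
rewrite (S'_exp Mv) der_expS // addrC /log_step -(S'_exp MEv).
under eq_bigr => n _ do rewrite D_S.
under [RHS]eq_bigr => g _ do rewrite mulrDl.
rewrite [RHS]big_split /=; congr (_ + _); last first.
  rewrite (bigD1 b) //= eqxx [X in _ + X]big1 ?addr0 => [//|g /negbTE ->].
  by rewrite mul0r.
pose f j m := x ^+ j * x ^+ m
  * Theta (iter j adjoint y) (S \o iter m (E b)) v.
transitivity (\sum_(n < M) n`!%:R^-1
    * \sum_(j < n.+1) f j (n - j)%N *+ 'C(n, j)).
  apply: eq_bigr => n _; rewrite -mulrA; congr (_ * _).
  rewrite -/(Theta y S _) Theta_iter mulr_sumr; apply: eq_bigr => j _.
  by rewrite /f -exprD subnKC -1?ltnS // mulrnAr.
rewrite (exponential_product F0 (p := d) (q := q)) //; last first.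
  move=> j m jm; rewrite /f /Theta big1 ?mulr0 // => k _.
  case/orP: jm => [dj | qm]; first by rewrite adjoint_nilpotent ?mul0r.
  by rewrite /= (iter_eq0 e0 qm (qE k)) S0 mulr0.
under [RHS]eq_bigr => g _ do rewrite mulr_suml.
rewrite [RHS]exchange_big /=; apply: eq_bigr => j _.
rewrite /f /Theta; under eq_bigr => m _ do rewrite mulr_sumr mulr_sumr.
rewrite exchange_big /=; apply: eq_bigr => g _.
rewrite (S'_exp (qE g)) /expS mulr_sumr; apply: eq_bigr => m _ /=.
by ring.
Qed.
End LogDerivative.

(** * Triangular matrices *)

Section Triangular.
Variables (F : fieldType) (n : nat).
Implicit Types A B G : 'M[F]_n.

Definition lower_triangular A := forall k l : 'I_n, (k < l)%N -> A k l = 0.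

Definition upper_unitriangular G :=
  forall k l : 'I_n, (l <= k)%N -> G k l = (k == l)%:R.

(** If G were not the identity, the first row and, in it, the last column
    where it differs from the identity would give an entry of A G = G B
    saying that two distinct diagonal entries of A agree. *)
Lemma unitriangular_conjugator A B G :
  lower_triangular A -> lower_triangular B -> (forall k, A k k = B k k) ->
  (forall k l, k != l -> A k k != A l l) ->
  upper_unitriangular G -> A *m G = G *m B -> G = 1%:M.
Proof.
move=> A_low B_low diagAB diag_inj G_up AG.
suff G0 (k l : 'I_n) : (k < l)%N -> G k l = 0.
  apply/matrixP => k l; rewrite mxE.
  case: (ltnP k l) => [kl | /G_up //]; rewrite G0 //.
  by rewrite -val_eqE /= ltn_eqF.
have [m] := ubnP (k : nat); elim: m k l => [//|m IHm] k l; rewrite ltnS => km.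
have [m'] := ubnP (n - l)%N; elim: m' l => [//|m' IHm'] l; rewrite ltnS => lm kl.
have := congr1 (fun M : 'M_n => M k l) AG; rewrite !mxE.
rewrite (bigD1 k) //= [X in _ + X]big1 ?addr0; last first.
  move=> p pk; case: (ltngtP p k) => [plk|kp|/val_inj e].
  - by rewrite (IHm p l) ?mulr0 //; [apply: leq_trans km | apply: ltn_trans kl].
  - by rewrite A_low ?mul0r.
  - by rewrite e eqxx in pk.
rewrite [RHS](bigD1 l) //= [X in _ = _ + X]big1 ?addr0; last first.
  move=> p pl; case: (ltngtP p l) => [plk|lp|/val_inj e].
  - by rewrite B_low ?mulr0.
  - rewrite (IHm' p) ?mul0r //; last exact: ltn_trans lp.
    by have := ltn_ord p; lia.
  - by rewrite e eqxx in pl.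
rewrite -diagAB => /eqP; rewrite mulrC -subr_eq0 -mulrBr mulf_eq0.
case/orP => [/eqP //|]; rewrite subr_eq0 (negbTE (diag_inj _ _ _)) //.
by rewrite -val_eqE /= ltn_eqF.
Qed.
End Triangular.

Section StrictlyUpper.
Variables (R : pzRingType) (n : nat) (r : 'M[R]_n).
Hypothesis r_up : forall k l : 'I_n, (l <= k)%N -> r k l = 0.

Lemma strictly_upper_iter m (v : 'M[R]_n) (k l : 'I_n) :
  (n <= k + m)%N -> iter m (mulmx r) v k l = 0.
Proof.
elim: m k => [|m IH] k; first by rewrite addn0 leqNgt ltn_ord.
move=> nk; rewrite /= mxE big1 // => p _.
case: (leqP p k) => [/r_up -> | kp]; first by rewrite mul0r.
by rewrite IH ?mulr0 //; lia.
Qed.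

Lemma strictly_upper_nilpotent (v : 'M[R]_n) : iter n (mulmx r) v = 0.
Proof. by apply/matrixP => k l; rewrite strictly_upper_iter ?mxE // leq_addl. Qed.

Lemma strictly_upper_iter1 m (k l : 'I_n) :
  (l < k + m)%N -> iter m (mulmx r) 1%:M k l = 0.
Proof.
elim: m k => [|m IH] k.
  by rewrite addn0 /= mxE => lk; rewrite -val_eqE /= gtn_eqF.
move=> lk; rewrite /= mxE big1 // => p _.
case: (leqP p k) => [/r_up -> | kp]; first by rewrite mul0r.
by rewrite IH ?mulr0 //; lia.
Qed.
End StrictlyUpper.

(** * Exponentials of nilpotent integer matrices *)

Section ExpMatrix.
Variables (F : fieldType) (n : nat).
Hypothesis F0 : char0 F.
Local Notation inF := (map_mx (intr : int -> F)).

Definition expM (x : F) (r : 'M[int]_n) : 'M[F]_n :=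
  \sum_(m < n) (m`!%:R^-1 * x ^+ m) *: inF (iter m (mulmx r) 1%:M).

Variable r : 'M[int]_n.
Hypothesis r_up : forall k l : 'I_n, (l <= k)%N -> r k l = 0.

Lemma expM_truncate x q : (q <= n)%N -> iter q (mulmx r) 1%:M = 0 ->
  expM x r = \sum_(m < q) (m`!%:R^-1 * x ^+ m) *: inF (iter m (mulmx r) 1%:M).
Proof.
move=> qn rq.
rewrite (big_ord_widen n (fun m => (m`!%:R^-1 * x ^+ m)
  *: inF (iter m (mulmx r) 1%:M))) // big_mkcond.
apply: eq_bigr => m _; case: ltnP => // qm.
by rewrite (iter_eq0 (mulmx0 _ r) qm rq) map_mx0 scaler0.
Qed.

Lemma expM_unitriangular x : upper_unitriangular (expM x r).
Proof.
move=> k l lk; rewrite summxE.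
have n0 : (0 < n)%N by apply: leq_ltn_trans (ltn_ord k).
rewrite (bigD1 (Ordinal n0)) //= [X in _ + X]big1 ?addr0.
  by rewrite fact0 expr0 invr1 !mxE !mul1r; case: (k == l).
move=> m m0; rewrite !mxE strictly_upper_iter1 // ?mulr0 //.
by move: m0; rewrite -val_eqE /=; lia.
Qed.

Lemma iter_mulmx m (v : 'M[int]_n) :
  iter m (mulmx r) v = iter m (mulmx r) 1%:M *m v.
Proof. by elim: m => [|m IH] /=; rewrite ?mul1mx // IH mulmxA. Qed.

(** An entry of G exp (x r) v as an exponential sum in the vector v. *)
Lemma expM_entry (G : 'M[F]_n) x p q (v : 'M[int]_n) M :
  iter M (mulmx r) v = 0 ->
  (G *m expM x r *m inF v) p q
  = expS (fun w => (G *m inF w) p q) (mulmx r) x M v.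
Proof.
move=> rv; rewrite (@expS_stable _ _ _ _ _ _ _ M n) ?mulmx0 //; first last.
- exact: strictly_upper_nilpotent.
- by rewrite map_mx0 mulmx0 mxE.
rewrite /expM /expS mulmx_sumr mulmx_suml summxE; apply: eq_bigr => m _.
by rewrite -scalemxAr -scalemxAl mxE -mulmxA -map_mxM -iter_mulmx.
Qed.

Lemma unitriangularM (G H : 'M[F]_n) :
  upper_unitriangular G -> upper_unitriangular H ->
  upper_unitriangular (G *m H).
Proof.
move=> Gu Hu k l lk; rewrite mxE (bigD1 k) //= Gu // eqxx mul1r Hu //.
rewrite big1 ?addr0 // => p pk.
case: (leqP p k) => [/Gu -> | kp]; first by rewrite eq_sym (negbTE pk) mul0r.
rewrite Hu; last by apply: leq_trans lk (ltnW kp).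
have -> : (p == l) = false by rewrite -val_eqE /= gtn_eqF //; apply: leq_ltn_trans kp.
by rewrite mulr0.
Qed.
End ExpMatrix.

(** * Poisson brackets *)

Section PoissonBracket.
Variables (k : fieldType) (A : comNzRingType) (c : {rmorphism k -> A}).
Variable br : A -> A -> A.
Hypothesis brP : is_poisson c br.

Lemma br_derivationl z : derivation_along id (br^~ z).
Proof.
split=> x y; last by rewrite (poisson_derl brP) addrC.
have := poisson_linearl brP (-1) y x z.
by rewrite rmorphN1 !mulN1r addrC => ->; rewrite addrC.
Qed.

Lemma br_derivationr z : derivation_along id (br z).
Proof.
split=> x y; last by rewrite (poisson_derr brP) addrC.
have := poisson_linearr brP (-1) y x z.
by rewrite rmorphN1 !mulN1r addrC => ->; rewrite addrC.
Qed.

Lemma br_const x t : br x (c t) = 0.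
Proof.
have dP := br_derivationr x.
have := poisson_linearr brP t 1 0 x.
by rewrite mulr1 addr0 (der1 dP) // (der0 dP) mulr0 addr0.
Qed.

Lemma br_ad x : forall y z, br x (br y z) = br (br x y) z + br y (br x z).
Proof.
move=> y z; have := poisson_jacobi brP x y z.
rewrite (poisson_skew brP z x) (poisson_skew brP z (br x y)) (zmodN (br_derivationr y).1).
by move=> /eqP; rewrite -addrA addr_eq0 opprD !opprK addrC => /eqP ->.
Qed.

Lemma br_self_double x : br x x *+ 2 = 0.
Proof. by apply/eqP; rewrite mulr2n addr_eq0 -(poisson_skew brP). Qed.
End PoissonBracket.

(** * Leibniz rule for iterated derivations *)

Section Leibniz.
Variables (V : zmodType) (op : V -> V -> V) (e : V -> V).
Hypotheses (op_addl : forall y, zmod_morphism (op^~ y))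
  (op_addr : forall x, zmod_morphism (op x)) (e_add : zmod_morphism e).
Hypothesis e_op : forall x y, e (op x y) = op (e x) y + op x (e y).

Lemma iter_leibniz n x y : iter n e (op x y)
  = \sum_(j < n.+1) op (iter j e x) (iter (n - j) e y) *+ 'C(n, j).
Proof.
elim: n => [|n IH]; first by rewrite big_ord1 bin0.
rewrite (pascal_sum (fun j m => op (iter j e x) (iter m e y))) iterS IH.
rewrite (zmod_sum e_add); apply: eq_bigr => j _.
by rewrite (zmodMn e_add) e_op addrC.
Qed.

Lemma iter_leibniz_eq0 p q x y : iter p e x = 0 -> iter q e y = 0 ->
  iter (p + q) e (op x y) = 0.
Proof.
have e0 := zmod0 e_add => xp yq; rewrite iter_leibniz big1 // => j _.
case: (leqP p j) => pj.
  by rewrite (iter_eq0 e0 pj xp) (zmod0 (op_addl _)) mul0rn.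
by rewrite (iter_eq0 e0 _ yq) ?(zmod0 (op_addr _)) ?mul0rn //; lia.
Qed.
End Leibniz.

(** * exp ((lambda / phi) ad phi) is canonical *)

Section ExpCanonical.
Variables (k : fieldType) (A : idomainType) (K : fieldType).
Variables (c : {rmorphism k -> A}) (cst : {rmorphism A -> K}).
Variables (br : A -> A -> A) (brK : K -> K -> K).
Hypotheses (brP : is_poisson c br) (brKP : is_poisson (cst \o c) brK).
Hypothesis brK_cst : forall x y, brK (cst x) (cst y) = cst (br x y).
Hypothesis K0 : char0 K.
Variables (lam : K) (phi : A).
Hypotheses (lam_central : forall f, brK lam f = 0) (phi0 : cst phi != 0).
Local Notation x := (lam / cst phi).
Local Notation e := (br phi).
Hypothesis e_nil : forall u, exists n, iter n e u = 0.
Variable sigma : A -> K.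
Hypothesis sigma_exp : forall u n, iter n e u = 0 ->
  sigma u = expS cst e x n u.

Let brK_derl (z : K) : derivation_along id (brK^~ z).
Proof. exact: (br_derivationl (c := cst \o c) brKP). Qed.
Let brK_derr (z : K) : derivation_along id (brK z).
Proof. exact: (br_derivationr (c := cst \o c) brKP). Qed.
Let e0 : e 0 = 0. Proof. exact: der0 (br_derivationr brP phi). Qed.

(** As lam is central, only the derivative of 1 / phi contributes. *)
Lemma brK_x u : brK x (cst u) = - (x / cst phi) * cst (e u).
Proof.
have lr := derM (brK_derl (cst u)) lam (cst phi)^-1.
rewrite lr lam_central mul0r add0r (derV (s := idfun) (brK_derl (cst u))) /=.
by rewrite brK_cst; field.
Qed.

Lemma brK_x_self : brK x x = 0.
Proof.
have xx := derM (brK_derl x) lam (cst phi)^-1.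
rewrite xx lam_central mul0r add0r (derV (s := idfun) (brK_derl x)) /=.
have xr := derM (brK_derr (cst phi)) lam (cst phi)^-1.
rewrite xr (poisson_skew brKP _ lam) lam_central oppr0 mul0r add0r.
rewrite (derV (s := idfun) (brK_derr (cst phi))) /= brK_cst.
have /eqP := congr1 cst (br_self_double brP phi).
rewrite rmorphMn rmorph0 -mulr_natl mulf_eq0.
by rewrite (negbTE (K0 1)) => /eqP ->; rewrite !mulr0.
Qed.

(** Expanding both series in the bracket of sigma u and sigma v, the brackets
    of the vectors give the series of sigma (br u v) by the Leibniz rule; the
    brackets of the powers of x with the vectors give
    - (x / phi) sigma (e u) sigma (e v) from the left series and its opposite
    from the right one. *)
Lemma exp_canonical u v : sigma (br u v) = brK (sigma u) (sigma v).
Proof.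
have [p up] := e_nil u; have [q vq] := e_nil v.
have eup : iter p e (e u) = 0 by rewrite -iterSr iterS up.
have evq : iter q e (e v) = 0 by rewrite -iterSr iterS vq.
have e_leib := br_ad brP phi.
have brl z : zmod_morphism (br^~ z) by exact: (br_derivationl brP z).1.
have brr z : zmod_morphism (br z) by exact: (br_derivationr brP z).1.
have uv := iter_leibniz_eq0 brl brr (brr phi) e_leib up vq.
(* The series for sigma (br u v), as a double sum. *)
pose f j m := x ^+ j * x ^+ m * cst (br (iter j e u) (iter m e v)).
have f0 j m : (p <= j)%N || (q <= m)%N -> f j m = 0.
  rewrite /f; case/orP=> h.
    by rewrite (iter_eq0 e0 h up) (zmod0 (brl _)) rmorph0 mulr0.
  by rewrite (iter_eq0 e0 h vq) (zmod0 (brr _)) rmorph0 mulr0.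
have -> : sigma (br u v) = \sum_(j < p) \sum_(m < q) j`!%:R^-1 * m`!%:R^-1 * f j m.
  rewrite -(exponential_product K0 (leqnn (p + q)) f0) (sigma_exp uv).
  apply: eq_bigr => n _; rewrite -mulrA; congr (_ * _).
  rewrite (iter_leibniz (brr phi) e_leib) rmorph_sum mulr_sumr.
  apply: eq_bigr => j _.
  by rewrite rmorphMn /f -exprD subnKC -1?ltnS // mulrnAr.
(* Brackets of x with the two series. *)
have brK_x_exp w n : iter n e w = 0 ->
    brK x (sigma w) = - (x / cst phi) * sigma (e w).
  move=> wn; have ewn : iter n e (e w) = 0 by rewrite -iterSr iterS wn.
  rewrite (sigma_exp wn) (der_expS K0 (brK_derr x) _ (rmorph0 _) e0 wn).
  rewrite brK_x_self mul0r add0r (sigma_exp ewn) /expS mulr_sumr.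
  by apply: eq_bigr => m _; rewrite brK_x -iterSr /=; ring.
rewrite (sigma_exp up).
rewrite (der_expS K0 (brK_derl (sigma v)) _ (rmorph0 _) e0 up).
rewrite (brK_x_exp _ _ vq) -(sigma_exp eup).
have brK_cst_exp w : brK (cst w) (sigma v)
    = x / cst phi * cst (e w) * sigma (e v)
      + \sum_(m < q) m`!%:R^-1 * x ^+ m * cst (br w (iter m e v)).
  rewrite {1}(sigma_exp vq).
  rewrite (der_expS K0 (brK_derr (cst w)) _ (rmorph0 _) e0 vq).
  rewrite -(sigma_exp evq) (poisson_skew brKP _ x) brK_x -mulNr opprK.
  by congr (_ + _); apply: eq_bigr => m _; rewrite brK_cst.
under [X in _ = _ + X]eq_bigr => n _ do rewrite brK_cst_exp mulrDr.
rewrite big_split /= addrA [X in _ = X + _](_ : _ = 0) ?add0r; last first.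
  rewrite (sigma_exp eup) /expS mulr_sumr -big_split /= big1 // => n _.
  by rewrite -iterSr /=; ring.
apply: eq_bigr => j _; rewrite mulr_sumr; apply: eq_bigr => m _.
by rewrite /f; ring.
Qed.
End ExpCanonical.

(** * Words in the reflections *)

Section Words.
Variables (K : fieldType) (I : eqType) (s : I -> {rmorphism K -> K}).

Fixpoint word_morph (u : seq I) : {rmorphism K -> K} :=
  if u is i :: u' then (s i \o word_morph u')%FUN else idfun.

Lemma word_morphE u : word_morph u =1 word_act s u.
Proof. by elim: u => //= i u IH x; rewrite /= IH. Qed.

Lemma word_morph_cat u v x :
  word_morph (u ++ v) x = word_morph u (word_morph v x).
Proof. by elim: u => //= i u ->. Qed.

Lemma word_morph_rcons u i x : word_morph (rcons u i) x = word_morph u (s i x).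
Proof. by rewrite -cats1 word_morph_cat. Qed.

Lemma word_morph_alternating i j m x :
  word_morph (flatten (nseq m [:: i; j])) x = iter m (s i \o s j) x.
Proof. by elim: m => //= m ->. Qed.
End Words.

(** * Lax matrices and the triviality of words *)

Section Lax.
Variables (k : fieldType) (A : idomainType) (K : fieldType).
Variables (c : {rmorphism k -> A}) (cst : {rmorphism A -> K}).
Variables (br : A -> A -> A).
Hypotheses (brP : is_poisson c br) (K0 : char0 K).
Variables (I : eqType) (phi : I -> A) (lam : I -> K).
Hypothesis e_nil : forall i u, exists n, iter n (br (phi i)) u = 0.
Variable s : I -> {rmorphism K -> K}.
Hypothesis s_exp : forall i u n, iter n (br (phi i)) u = 0 ->
  s i (cst u) = expS cst (br (phi i)) (lam i / cst (phi i)) n u.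
Variable D : K -> K.
Hypotheses (DP : derivation_along id D) (D_cst : forall u, D (cst u) = 0).

Local Notation inK := (map_mx (intr : int -> K)).

(** The data that make every word in the reflections indexed by [letters]
    trivial on A as soon as it fixes the diagonal of [lax]. The elements
    [root b] of A span a nilpotent Lie algebra with structure constants
    [str], and [rho] is a faithful representation of it by strictly upper
    triangular integer matrices. The reflections act on [lax] by conjugation
    with exponentials of that representation. *)
Record lax_data (letters : pred I) (d n : nat) := LaxData {
  root : 'I_d -> A;
  simple : I -> 'I_d;
  str : I -> 'M[int]_d;
  rho : 'I_d -> 'M[int]_n;
  lax : 'M[K]_n;
  root_simple : forall i, letters i -> root (simple i) = phi i;
  str_upper : forall i b g, letters i -> str i b g != 0 -> (b < g)%N;
  root_bracket : forall i b, letters i ->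
    br (root b) (phi i) = \sum_g root g *~ str i b g;
  rho_upper : forall b (p q : 'I_n), (q <= p)%N -> rho b p q = 0;
  rho_bracket : forall i b, letters i ->
    rho b *m rho (simple i)
    = rho (simple i) *m rho b + \sum_g rho g *~ str i b g;
  rho_free : forall y : 'I_d -> K,
    \sum_b y b *: inK (rho b) = 0 -> forall b, y b = 0;
  lax_lower : lower_triangular lax;
  lax_weights : forall f : {rmorphism K -> K},
    (forall i, letters i -> f (lam i) = lam i) ->
    forall p, f (lax p p) = lax p p;
  lax_diag : forall p q, p != q -> lax p p != lax q q;
  lax_reflection : forall i, letters i ->
    let G := expM (lam i / cst (phi i)) (rho (simple i)) in
    lax *m G = G *m map_mx (s i) lax
}.

Variables (letters : pred I) (d n : nat) (L : lax_data letters d n).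
Local Notation word := (word_morph s).

(** The vector y is the logarithmic derivative of the product of exponentials
    that represents the word. It serves A and the matrices at once, because
    log_step depends only on the structure constants and on the parameters x of
    the exponentials, which are the same on both sides. *)
Lemma word_log_derivative u : all letters u ->
  exists (y : 'I_d -> K) (G : 'M[K]_n),
  [/\ forall v, D (word u (cst v))
        = \sum_b y b * word u (cst (br (root L b) v)),
      forall p q (v : 'M[int]_n), D ((G *m inK v) p q)
        = \sum_b y b * (G *m inK (rho L b *m v)) p q,
      upper_unitriangular G
    & lax L *m G = G *m map_mx (word u) (lax L)].
Proof.
have brl z : zmod_morphism (br^~ z) by exact: (br_derivationl brP z).1.
have brr z : zmod_morphism (br z) by exact: (br_derivationr brP z).1.
elim/last_ind: u => [_ | u i IH].
  exists (fun=> 0), 1%:M; split.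
  - by move=> v; rewrite /= D_cst big1 // => b _; rewrite mul0r.
  - move=> p q v; rewrite mul1mx mxE big1 => [|b _]; last by rewrite mul0r.
    by rewrite -(rmorph_int cst) D_cst.
  - by move=> p q qp; rewrite mxE.
  - by rewrite mulmx1 mul1mx; apply/matrixP => p q; rewrite mxE.
rewrite all_rcons => /andP[li lu]; have {IH} [y [G [yA yG Gu GF]]] := IH lu.
set x := word u (lam i / cst (phi i)).
set r := rho L (simple L i).
have r_up := @rho_upper _ _ _ L (simple L i).
exists (log_step D (str L i) (simple L i) x y), (G *m expM x r); split.
- move=> v; rewrite word_morph_rcons.
  under eq_bigr => b _ do rewrite word_morph_rcons.
  apply: (log_derivative_step K0 DP _ _ _ _ _ _ yA (S' := word u \o s i \o cst)).
  + by move=> b g; apply: str_upper.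
  + by move=> a b; rewrite !rmorphB.
  + by move=> b; apply: brr.
  + move=> b w /=; rewrite (br_ad brP) (root_simple L li) addrC.
    rewrite (root_bracket L _ li); congr (_ + _).
    rewrite (zmod_sum (brl w)); apply: eq_bigr => g _.
    exact: (zmodMz (brl w)).
  + by move=> w; rewrite (root_simple L li); apply: e_nil.
  + move=> w m; rewrite (root_simple L li) => wm /=.
    rewrite (s_exp wm) rmorph_sum; apply: eq_bigr => p _.
    by rewrite !rmorphM rmorphXn fmorphV rmorph_nat.
- move=> p q v.
  apply: (log_derivative_step K0 DP _ _ _ _ _ _ (yG p q)
    (S' := fun v => (G *m expM x r *m inK v) p q)).
  + by move=> b g; apply: str_upper.
  + by move=> a b; rewrite map_mxB mulmxBr !mxE.
  + by move=> b a a'; rewrite mulmxBr.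
  + move=> b w; rewrite !mulmxA (rho_bracket L _ li) mulmxDl; congr (_ + _).
    rewrite mulmx_suml; apply: eq_bigr => g _.
    by rewrite -!scaler_int scalemxAl.
  + by move=> w; exists n; apply: strictly_upper_nilpotent.
  + by move=> w m wm; apply: expM_entry.
- by apply: unitriangularM => //; apply: expM_unitriangular.
- rewrite mulmxA GF -!mulmxA; congr (_ *m _).
  have -> : expM x r = map_mx (word u) (expM (lam i / cst (phi i)) r).
    rewrite /expM map_mx_sum; apply: eq_bigr => m _; rewrite map_mxZ.
    rewrite rmorphM rmorphXn fmorphV rmorph_nat; congr (_ *: _).
    by apply/matrixP => p q; rewrite !mxE rmorph_int.
  rewrite -map_mxM (lax_reflection L li) map_mxM; congr (_ *m _).
  by apply/matrixP => p q; rewrite !mxE word_morph_rcons.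
Qed.

(** If the word fixes the diagonal of [lax], its matrix conjugates [lax] into
    another lower triangular matrix with the same diagonal, so it is 1. Its
    logarithmic derivative is then 0, and by faithfulness so is y. *)
Lemma word_constant u : all letters u ->
  (forall i, letters i -> word u (lam i) = lam i) ->
  forall v, D (word u (cst v)) = 0.
Proof.
move=> lu /(lax_weights L) diag v.
have [y [G [yA yG Gu GF]]] := word_log_derivative lu.
have G1 : G = 1%:M.
  apply: (unitriangular_conjugator _ _ _ _ Gu GF).
  - exact: lax_lower.
  - by move=> p q pq; rewrite mxE lax_lower // rmorph0.
  - by move=> p; rewrite mxE diag.
  - exact: lax_diag.
have y0 : forall b, y b = 0.
  apply: (@rho_free _ _ _ L); apply/matrixP => p q.
  have := yG p q 1%:M; rewrite G1 mul1mx [in LHS]mxE -(rmorph_int cst) D_cst.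
  move=> e; rewrite summxE mxE [RHS]e; apply: eq_bigr => b _.
  by rewrite mulmx1 mul1mx !mxE.
by rewrite yA big1 // => b _; rewrite y0 mul0r.
Qed.
End Lax.

(** * Matrices given by rows *)

Definition rows_mx (R : pzSemiRingType) n (l : seq (seq R)) : 'M[R]_n :=
  \matrix_(p, q) nth 0 (nth [::] l p) q.
Arguments rows_mx {R} n l.

Definition mul_rows (R : pzSemiRingType) n (l l' : seq (seq R)) :=
  mkseq (fun p => mkseq (fun q =>
    foldr (fun m z => nth 0 (nth [::] l p) m * nth 0 (nth [::] l' m) q + z)
      0 (iota 0 n)) n) n.

Lemma sum_ord_foldr (V : nmodType) n (f : nat -> V) :
  \sum_(m < n) f m = foldr (fun m z => f m + z) 0 (iota 0 n).
Proof.
rewrite -(big_mkord xpredT) unlock /index_iota subn0.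
by elim: (iota 0 n) => //= m t ->.
Qed.

Lemma mul_rows_mx (R : pzSemiRingType) n (l l' : seq (seq R)) :
  rows_mx n (mul_rows n l l') = rows_mx n l *m rows_mx n l'.
Proof.
apply/matrixP => p q; rewrite !mxE !nth_mkseq // -sum_ord_foldr.
by apply: eq_bigr => m _; rewrite !mxE.
Qed.

Lemma map_rows_mx (R S : pzSemiRingType) (f : R -> S) n (l : seq (seq R)) :
  f 0 = 0 -> map_mx f (rows_mx n l) = rows_mx n (map (map f) l).
Proof.
move=> f0; apply/matrixP => p q; rewrite !mxE.
have [pl|lp] := ltnP p (size l); last first.
  by rewrite !(nth_default [::]) ?size_map // !nth_nil.
rewrite (nth_map [::]) //; have [ql|lq] := ltnP q (size (nth [::] l p)).
  by rewrite (nth_map 0).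
by rewrite !(nth_default 0) ?size_map.
Qed.

(** For a numeral n the hypothesis unfolds to n separate goals, each about an
    explicit index. *)
Lemma all_ord n (P : nat -> Prop) :
  foldr (fun m Q => P m /\ Q) True (iota 0 n) -> forall p : 'I_n, P p.
Proof.
move=> h p; have : (p : nat) \in iota 0 n by rewrite mem_iota ltn_ord.
by elim: (iota 0 n) h => //= m t IH [Pm ht]; rewrite inE => /orP[/eqP->|/IH]; auto.
Qed.

Lemma rows_mx_eq (R : pzSemiRingType) n (l l' : seq (seq R)) :
  foldr (fun p P => foldr (fun q Q =>
      nth 0 (nth [::] l p) q = nth 0 (nth [::] l' p) q /\ Q) True (iota 0 n) /\ P)
    True (iota 0 n) ->
  rows_mx n l = rows_mx n l'.
Proof.
move=> h; apply/matrixP => p q; rewrite !mxE.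
have := all_ord (P := fun p => foldr (fun q Q =>
  nth 0 (nth [::] l p) q = nth 0 (nth [::] l' p) q /\ Q) True (iota 0 n)) h p.
by move/(@all_ord n (fun q => nth 0 (nth [::] l p) q = nth 0 (nth [::] l' p) q)).
Qed.

Lemma all_ordb n (P : pred nat) : all P (iota 0 n) -> forall p : 'I_n, P p.
Proof. by move=> /allP h p; apply: h; rewrite mem_iota ltn_ord. Qed.

(** * Rank two data *)

Section RankTwoData.
Variables (A : idomainType) (K : fieldType) (cst : {rmorphism A -> K}).
Variables (br : A -> A -> A).
Hypothesis K0 : char0 K.
Variables (I : eqType) (phi : I -> A) (lam : I -> K).
Variable s : I -> {rmorphism K -> K}.
Variables (i j : I).
Hypothesis ij : i != j.
Hypothesis lam_free : forall p q : int,
  lam i *~ p + lam j *~ q = 0 -> p = 0 /\ q = 0.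

(** The data are given by lists, so that all conditions on integers are checked
    by computation at once. The lists [roots] and [R] start with the two simple
    roots i and j; [N 0] and [N 1] are the matrices of bracketing with them.
    [W] lists the diagonal entries of [L] by their coordinates on lam i and
    lam j. *)
Section Builder.
Variables (d n : nat) (roots : seq A).
Variables (N : nat -> seq (seq int)) (R : seq (seq (seq int))).
Variables (L : seq (seq K)) (W : seq (int * int)) (pos : seq (nat * nat)).

Local Notation entry l p q := (nth 0 (nth [::] l p) q).
Local Notation R_ b := (nth [::] R b).
Local Notation sumf m n F := (foldr (fun m z => F + z) 0 (iota 0 n)).

Definition str_upper_check t := all (fun b => all (fun g =>
  (entry (N t) b g != 0) ==> (b < g)%N) (iota 0 d.+2)) (iota 0 d.+2).

Definition rho_upper_check := all (fun b => all (fun p => all (fun q =>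
  (q <= p)%N ==> (entry (R_ b) p q == 0)) (iota 0 n)) (iota 0 n)) (iota 0 d.+2).

Definition rho_bracket_check t := all (fun b => all (fun p => all (fun q =>
    sumf m n (entry (R_ b) p m * entry (R_ t) m q)
    == sumf m n (entry (R_ t) p m * entry (R_ b) m q)
       + sumf g d.+2 (entry (R_ g) p q * entry (N t) b g))
  (iota 0 n)) (iota 0 n)) (iota 0 d.+2).

(** Each matrix of the representation has an entry, listed in [pos], where
    all the others vanish. *)
Definition rho_free_check := all (fun b => let (p, q) := nth (0, 0)%N pos b in
    [&& (p < n)%N, (q < n)%N
      & all (fun g => (entry (R_ g) p q != 0) == (g == b)) (iota 0 d.+2)])
  (iota 0 d.+2).

Definition rank_two_check := [&& all str_upper_check (iota 0 2),
  rho_upper_check, all rho_bracket_check (iota 0 2), rho_free_check,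
  uniq W & size W == n].

Hypotheses (root0 : nth 0 roots 0 = phi i) (root1 : nth 0 roots 1 = phi j).
Hypothesis check : rank_two_check.
Hypothesis roots_br : forall t, (t <= 1)%N ->
  foldr (fun b P => br (nth 0 roots b) (nth 0 roots t)
      = sumf g d.+2 (nth 0 roots g *~ entry (N t) b g) /\ P) True (iota 0 d.+2).
Hypothesis L_low : foldr (fun p P => foldr (fun q Q =>
    ((p < q)%N -> entry L p q = 0) /\ Q) True (iota 0 n) /\ P) True (iota 0 n).
Hypothesis L_diag : foldr (fun p P => entry L p p
    = lam i *~ (nth (0, 0) W p).1 + lam j *~ (nth (0, 0) W p).2 /\ P)
  True (iota 0 n).
Hypothesis L_refl0 :
  let G := expM (lam i / cst (phi i)) (rows_mx n (R_ 0)) in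
  rows_mx n L *m G = G *m rows_mx n (map (map (s i)) L).
Hypothesis L_refl1 :
  let G := expM (lam j / cst (phi j)) (rows_mx n (R_ 1)) in
  rows_mx n L *m G = G *m rows_mx n (map (map (s j)) L).

(* The index of a letter in these lists is 0 for i and 1 for j. *)
Let simple2 (i' : I) : 'I_d.+2 := if i' == i then ord0 else lift ord0 ord0.
Let simple2E i' : simple2 i' = (i' != i) :> nat.
Proof. by rewrite /simple2; case: eqP. Qed.

Lemma rank_two_data : lax_data cst br phi lam s (pred2 i j) d.+2 n.
Proof.
have [N_up R_up R_br R_free /andP[W_uniq /eqP W_size]] := and5P check.
have two (i' : I) : ((i' != i) : nat) \in iota 0 2 by case: (i' != i).
have nth_root i' : pred2 i j i' -> nth 0 roots (i' != i) = phi i'.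
  by case/pred2P => ->; rewrite ?eqxx // eq_sym ij.
refine (@LaxData _ _ _ _ _ _ _ _ _ _ _ (fun b => nth 0 roots b) simple2
  (fun i' => rows_mx d.+2 (N (i' != i))) (fun b => rows_mx n (R_ b))
  (rows_mx n L) _ _ _ _ _ _ _ _ _ _).
- by move=> i' li; rewrite simple2E nth_root.
- move=> i' b g _; rewrite mxE.
  by have /all_ordb/(_ b)/all_ordb/(_ g)/implyP := allP N_up _ (two i').
- move=> i' b li; rewrite -(nth_root _ li).
  have /(@all_ord d.+2 (fun b => br (nth 0 roots b) (nth 0 roots (i' != i))
    = sumf g d.+2 (nth 0 roots g *~ entry (N (i' != i)) b g))) -> :=
    roots_br (leq_b1 (i' != i)).
  rewrite -sum_ord_foldr; apply: eq_bigr => g _.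
  by rewrite mxE.
- move=> b p q qp; rewrite mxE.
  by have /all_ordb/(_ b)/all_ordb/(_ p)/all_ordb/(_ q)/implyP/(_ qp)/eqP := R_up.
- move=> i' b li; rewrite simple2E; apply/matrixP => p q.
  have /all_ordb/(_ b)/all_ordb/(_ p)/all_ordb/(_ q)/eqP := allP R_br _ (two i').
  rewrite -!sum_ord_foldr !mxE summxE => e.
  under eq_bigr => m _ do rewrite !mxE.
  rewrite e; congr (_ + _); apply: eq_bigr => m _; rewrite ?mxE //.
  by rewrite -scaler_int !mxE intz mulrC.
- move=> y y0 b; have /all_ordb/(_ b) := R_free.
  case: (nth _ _ _) => p q /and3P[pn qn /all_ordb pos_b].
  have := congr1 (fun M : 'M_n => M (Ordinal pn) (Ordinal qn)) y0.
  rewrite summxE mxE (bigD1 b) //= big1 ?addr0 => [|g gb]; last first.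
    have /eqP/= := pos_b g; rewrite !mxE /= val_eqE (negbTE gb).
    by move=> /negbFE/eqP ->; rewrite mulr0.
  rewrite !mxE /= => /eqP; rewrite mulf_eq0 => /orP[/eqP //|].
  rewrite (char0_intr_eq0 _ K0).
  by have /eqP/= := pos_b b; rewrite eqxx => /negbTE ->.
- move=> p q pq; rewrite mxE.
  have h := @all_ord n (fun p => foldr (fun q Q =>
    ((p < q)%N -> entry L p q = 0) /\ Q) True (iota 0 n)) L_low p.
  exact: (@all_ord n (fun q => (p < q)%N -> entry L p q = 0) h q).
- move=> f fl p; rewrite mxE.
  rewrite (@all_ord n (fun p => entry L p p
    = lam i *~ (nth (0, 0) W p).1 + lam j *~ (nth (0, 0) W p).2) L_diag p).
  by rewrite rmorphD !rmorphMz !fl //= eqxx ?orbT.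
- move=> p q pq; rewrite !mxE.
  have h := @all_ord n (fun p => entry L p p
    = lam i *~ (nth (0, 0) W p).1 + lam j *~ (nth (0, 0) W p).2) L_diag.
  rewrite (h p) (h q); apply: contraNneq pq => /eqP.
  rewrite -subr_eq0 opprD addrACA -!mulrzBr => /eqP/lam_free[/eqP e1 /eqP e2].
  move: e1 e2; rewrite !subr_eq0 => /eqP e1 /eqP e2.
  rewrite -val_eqE -(nth_uniq (0, 0) _ _ W_uniq) ?W_size //=.
  by rewrite [nth _ W p]surjective_pairing e1 e2 -surjective_pairing.
- move=> i' /pred2P[] -> /=; rewrite simple2E map_rows_mx ?rmorph0 // ?eqxx //.
  by rewrite eq_sym ij.
Qed.
End Builder.
End RankTwoData.

Definition cube0_check n (l l2 : seq (seq int)) :=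
  all (fun p => all (fun q =>
      (nth 0 (nth [::] (mul_rows n l l) p) q == nth 0 (nth [::] l2 p) q)
      && (nth 0 (nth [::] (mul_rows n l l2) p) q == 0))
    (iota 0 n)) (iota 0 n).

(** The simple root vectors of the four representations used below have cube
    0, so that the exponential is 1 + x l + x^2 l^2 / 2. *)
Lemma expM_rows (F : fieldType) n x (l l2 : seq (seq int)) (E : seq (seq F)) :
  (2 < n)%N -> cube0_check n l l2 ->
  foldr (fun p P => foldr (fun q Q =>
      (p == q)%:R + x * (nth 0 (nth [::] l p) q)%:~R
      + x ^+ 2 / 2%:R * (nth 0 (nth [::] l2 p) q)%:~R
      = nth 0 (nth [::] E p) q /\ Q) True (iota 0 n) /\ P) True (iota 0 n) ->
  expM x (rows_mx n l) = rows_mx n E.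
Proof.
move=> n3 check h.
have ll : rows_mx n l *m rows_mx n l = rows_mx n l2.
  rewrite -mul_rows_mx; apply/matrixP => p q; rewrite !mxE.
  by have /all_ordb/(_ p)/all_ordb/(_ q)/andP[/eqP] := check.
have ll2 : rows_mx n l *m rows_mx n l2 = 0.
  rewrite -mul_rows_mx; apply/matrixP => p q; rewrite !mxE.
  by have /all_ordb/(_ p)/all_ordb/(_ q)/andP[_ /eqP] := check.
have r3 : iter 3 (mulmx (rows_mx n l)) 1%:M = 0 by rewrite /= mulmx1 ll.
rewrite (expM_truncate _ n3 r3) !big_ord_recl big_ord0 /= mulmx1 ll addr0.
apply/matrixP => p q.
have hp := @all_ord n (fun p => foldr (fun q Q =>
      (p == q)%:R + x * (nth 0 (nth [::] l p) q)%:~R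
      + x ^+ 2 / 2%:R * (nth 0 (nth [::] l2 p) q)%:~R
      = nth 0 (nth [::] E p) q /\ Q) True (iota 0 n)) h p.
have := @all_ord n (fun q => (p == q :> nat)%:R
      + x * (nth 0 (nth [::] l p) q)%:~R
      + x ^+ 2 / 2%:R * (nth 0 (nth [::] l2 p) q)%:~R
      = nth 0 (nth [::] E p) q) hp q.
rewrite !mxE => <-; rewrite /bump /= !factS fact0 !muln1 expr0 expr1 invr1.
rewrite !mul1r -addrA; congr (_ + _); first by rewrite -val_eqE /=; case: eqP.
by rewrite [_^-1 * _ ^+ 2]mulrC.
Qed.

(** * The four rank two types *)

Ltac entries :=
  repeat match goal with |- _ /\ _ => split end; try exact Logic.I.

(** In each type [rho] lists the matrices of the basis e_i, e_j, [e_i, e_j],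
    [e_i, [e_i, e_j]] and so on of the nilpotent Lie algebra, in the order of
    increasing height, in the smallest faithful representation of the semisimple
    Lie algebra. The matrix [lax] lies in the opposite Borel subalgebra of that
    Lie algebra and is determined, up to a common factor, by the trace form: the
    trace of [lax] times the matrix of a basis vector is the corresponding
    bracket of phi i and phi j, and its trace with the simple coroots is lam i
    and lam j. Conjugation preserves the trace form, and the parameter
    lam i / cst (phi i) of the exponential is the one that keeps [lax] lower
    triangular; hence conjugating [lax] has the effect of s i on its entries. *)
Section RankTwo.
Variables (k : fieldType) (A : idomainType) (K : fieldType).
Variables (c : {rmorphism k -> A}) (cst : {rmorphism A -> K}).
Variables (br : A -> A -> A).
Hypotheses (brP : is_poisson c br) (A_0 : char0 A) (K0 : char0 K).
Variables (I : eqType) (phi : I -> A) (lam : I -> K) (a : I -> I -> int).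
Variable s : I -> {rmorphism K -> K}.
Hypothesis s_exp : forall i u n, iter n (br (phi i)) u = 0 ->
  s i (cst u) = expS cst (br (phi i)) (lam i / cst (phi i)) n u.
Hypothesis s_lam : forall i j, s i (lam j) = lam j - lam i *~ a j i.
Hypothesis a_diag : forall i, a i i = 2.
Hypothesis phi_neq0 : forall i, cst (phi i) != 0.
Variables (i j : I).
Hypothesis ij : i != j.
Hypothesis lam_free : forall p q : int,
  lam i *~ p + lam j *~ q = 0 -> p = 0 /\ q = 0.

Local Notation x h := (lam h / cst (phi h)).

Lemma lamE h : lam h = x h * cst (phi h).
Proof. by rewrite divfK. Qed.

Lemma s_self h : s h (lam h) = - lam h.
Proof. by rewrite s_lam a_diag; ring. Qed.

Lemma br00 h : br h 0 = 0. Proof. exact: (der0 (br_derivationr brP h)). Qed.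

Lemma brN u v : br u (- v) = - br u v.
Proof. exact: (zmodN (br_derivationr brP u).1). Qed.

Lemma br_self u : br u u = 0.
Proof.
have /eqP := br_self_double brP u; rewrite -mulr_natl mulf_eq0.
by rewrite (negbTE (A_0 1)) => /eqP.
Qed.

Lemma s_chain h u0 u1 u2 u3 :
  br (phi h) u0 = u1 -> br (phi h) u1 = u2 -> br (phi h) u2 = u3 ->
  br (phi h) u3 = 0 ->
  s h (cst u0) = cst u0 + x h * cst u1 + x h ^+ 2 / 2%:R * cst u2
    + x h ^+ 3 / 6%:R * cst u3.
Proof.
move=> e1 e2 e3 e4.
have e : iter 4 (br (phi h)) u0 = 0 by rewrite /= e1 e2 e3.
rewrite (s_exp e) /expS !big_ord_recl big_ord0 /= e1 e2 e3 /bump /=.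
rewrite !factS fact0; have := K0 1; have := K0 5; move=> h6 h2.
by rewrite !muln1; field; rewrite h6 h2 phi_neq0 oner_neq0.
Qed.

Lemma s_chain1 h u0 u1 : br (phi h) u0 = u1 -> br (phi h) u1 = 0 ->
  s h (cst u0) = cst u0 + x h * cst u1.
Proof.
move=> e1 e2; rewrite (s_chain e1 e2 (br00 _) (br00 _)) rmorph0 !mulr0.
by rewrite !addr0.
Qed.

Lemma s_fixed h u : br (phi h) u = 0 -> s h (cst u) = cst u.
Proof. by move=> e; rewrite (s_chain1 e (br00 _)) rmorph0 mulr0 addr0. Qed.

Lemma s_phi h : s h (cst (phi h)) = cst (phi h).
Proof. exact: s_fixed (br_self _). Qed.

(** ** Type A1 x A1 *)

Definition rho_A1A1 : seq (seq (seq int)) :=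
  [:: [:: [:: 0; 1]; [::]; [::]; [::]];
      [:: [::]; [::]; [:: 0; 0; 0; 1]; [::]] ].

Definition lax_A1A1 (F : pzRingType) (l1 l2 p1 p2 : F) : seq (seq F) :=
  [:: [:: l1];
      [:: p1 *+ 2; - l1];
      [:: 0; 0; l2];
      [:: 0; 0; p2 *+ 2; - l2] ].

Lemma data_A1A1 : a i j = 0 -> a j i = 0 -> br (phi i) (phi j) = 0 ->
  lax_data cst br phi lam s (pred2 i j) 2 4.
Proof.
move=> aij aji b12; have b21 : br (phi j) (phi i) = 0.
  by rewrite (poisson_skew brP) b12 oppr0.
apply: (rank_two_data K0 ij lam_free (roots := [:: phi i; phi j])
  (N := fun=> [::]) (R := rho_A1A1)
  (L := lax_A1A1 (lam i) (lam j) (cst (phi i)) (cst (phi j)))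
  (W := [:: (1, 0); (-1, 0); (0, 1); (0, -1)])
  (pos := [:: (0, 1); (2, 3)]%N)).
- by [].
- by [].
- by vm_compute.
- by case=> [|[|//]] _; rewrite /= !mulr0z !addr0 !br_self ?b12 ?b21.
- by [].
- by rewrite /= !mulr0z !mulr1z !mulrN1z !addr0 !add0r.
- rewrite /= !(rmorphD, rmorphN, rmorphMn, rmorph0) /= s_self s_lam aji mulr0z.
  rewrite subr0 s_phi (s_fixed b12).
  rewrite (expM_rows (l2 := [::]) (E :=
      [:: [:: 1; x i]; [:: 0; 1]; [:: 0; 0; 1]; [:: 0; 0; 0; 1]])).
  + move: (x i) (lamE i) => z ->; rewrite -!mul_rows_mx; apply: rows_mx_eq.
    rewrite /mul_rows /mkseq /=; entries; by ring.
  + by [].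
  + by vm_compute.
  + rewrite /=. entries; by rewrite ?mulr0z ?mulr1z; ring.
- rewrite /= !(rmorphD, rmorphN, rmorphMn, rmorph0) /= s_self s_lam aij mulr0z.
  rewrite subr0 s_phi (s_fixed b21).
  rewrite (expM_rows (l2 := [::]) (E :=
      [:: [:: 1]; [:: 0; 1]; [:: 0; 0; 1; x j]; [:: 0; 0; 0; 1]])).
  + move: (x j) (lamE j) => z ->; rewrite -!mul_rows_mx; apply: rows_mx_eq.
    rewrite /mul_rows /mkseq /=; entries; by ring.
  + by [].
  + by vm_compute.
  + rewrite /=. entries; by rewrite ?mulr0z ?mulr1z; ring.
Qed.

(** ** Type A2 *)

Definition rho_A2 : seq (seq (seq int)) :=
  [:: [:: [:: 0; 1]; [::]; [::]];
      [:: [::]; [:: 0; 0; 1]; [::]];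
      [:: [:: 0; 0; 1]; [::]; [::]] ].

Definition str_A2 (t : nat) : seq (seq int) :=
  if t is 0 then [:: [::]; [:: 0; 0; -1]] else [:: [:: 0; 0; 1]].

Definition lax_A2 (F : pzRingType) (l1 l2 p1 p2 p12 : F) : seq (seq F) :=
  [:: [:: l1 *+ 2 + l2];
      [:: p1 *+ 3; - l1 + l2];
      [:: p12 *+ 3; p2 *+ 3; - l1 - l2 *+ 2] ].

Lemma data_A2 : a i j = -1 -> a j i = -1 ->
  iter 2 (br (phi i)) (phi j) = 0 -> iter 2 (br (phi j)) (phi i) = 0 ->
  lax_data cst br phi lam s (pred2 i j) 3 3.
Proof.
move=> aij aji /=; set u := br (phi i) (phi j) => iu0.
have ji : br (phi j) (phi i) = - u by rewrite (poisson_skew brP).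
rewrite ji brN => /eqP; rewrite oppr_eq0 => /eqP ju0.
have ui : br u (phi i) = 0 by rewrite (poisson_skew brP) iu0 oppr0.
have uj : br u (phi j) = 0 by rewrite (poisson_skew brP) ju0 oppr0.
apply: (rank_two_data K0 ij lam_free (roots := [:: phi i; phi j; u])
  (N := str_A2) (R := rho_A2)
  (L := lax_A2 (lam i) (lam j) (cst (phi i)) (cst (phi j)) (cst u))
  (W := [:: (2, 1); (-1, 1); (-1, -2)])
  (pos := [:: (0, 1); (1, 2); (0, 2)]%N)).
- by [].
- by [].
- by vm_compute.
- case=> [|[|//]] _; rewrite /= -/u !br_self ?ji ?ui ?uj;
  by entries; rewrite ?mulr0z; ring.
- by [].
- by rewrite /=; entries; ring.
- rewrite /= !(rmorphD, rmorphN, rmorphMn) /= s_self s_lam aji.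
  rewrite s_phi (s_chain1 (erefl u) iu0) (s_fixed iu0).
  rewrite (expM_rows (l2 := [::]) (E :=
      [:: [:: 1; x i]; [:: 0; 1]; [:: 0; 0; 1]])).
  + move: (x i) (lamE i) => z ->; rewrite -!mul_rows_mx; apply: rows_mx_eq.
    by rewrite /mul_rows /mkseq /=; entries; ring.
  + by [].
  + by vm_compute.
  + by rewrite /=; entries; rewrite ?mulr0z ?mulr1z; ring.
- rewrite /= !(rmorphD, rmorphN, rmorphMn) /= s_self s_lam aij.
  rewrite s_phi (s_chain1 ji) ?brN ?ju0 ?oppr0 // (s_fixed ju0) rmorphN.
  rewrite (expM_rows (l2 := [::]) (E :=
      [:: [:: 1]; [:: 0; 1; x j]; [:: 0; 0; 1]])).
  + move: (x j) (lamE j) => z ->; rewrite -!mul_rows_mx; apply: rows_mx_eq.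
    by rewrite /mul_rows /mkseq /=; entries; ring.
  + by [].
  + by vm_compute.
  + by rewrite /=; entries; rewrite ?mulr0z ?mulr1z; ring.
Qed.

(** ** Type B2 *)

Definition rho_B2 : seq (seq (seq int)) :=
  [:: [:: [:: 0; 1]; [::]; [:: 0; 0; 0; -1]; [::]];
      [:: [::]; [:: 0; 0; 1]; [::]; [::]];
      [:: [:: 0; 0; 1]; [:: 0; 0; 0; 1]; [::]; [::]];
      [:: [:: 0; 0; 0; 2]; [::]; [::]; [::]] ].

Definition str_B2 (t : nat) : seq (seq int) :=
  if t is 0 then [:: [::]; [:: 0; 0; -1]; [:: 0; 0; 0; -1]]
  else [:: [:: 0; 0; 1]].

Definition lax_B2 (F : pzRingType) (l1 l2 p1 p2 p12 p112 : F) : seq (seq F) :=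
  [:: [:: l1 + l2];
      [:: p1; l2];
      [:: p12; p2 *+ 2; - l2];
      [:: p112; p12; - p1; - l1 - l2] ].

Lemma data_B2 : a i j = -2 -> a j i = -1 ->
  iter 3 (br (phi i)) (phi j) = 0 -> iter 2 (br (phi j)) (phi i) = 0 ->
  lax_data cst br phi lam s (pred2 i j) 4 4.
Proof.
move=> aij aji /=; set u := br (phi i) (phi j); set v := br (phi i) u => iv0.
have ji : br (phi j) (phi i) = - u by rewrite (poisson_skew brP).
rewrite ji brN => /eqP; rewrite oppr_eq0 => /eqP ju0.
have jv0 : br (phi j) v = 0.
  rewrite /v (br_ad brP) ju0 br00 addr0 ji (poisson_skew brP) brN br_self.
  by rewrite !oppr0.
have ui : br u (phi i) = - v by rewrite (poisson_skew brP).
have vi : br v (phi i) = 0 by rewrite (poisson_skew brP) iv0 oppr0.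
have uj : br u (phi j) = 0 by rewrite (poisson_skew brP) ju0 oppr0.
have vj : br v (phi j) = 0 by rewrite (poisson_skew brP) jv0 oppr0.
have K2 : 2%:R != 0 :> K by apply: K0.
apply: (rank_two_data K0 ij lam_free (roots := [:: phi i; phi j; u; v])
  (N := str_B2) (R := rho_B2)
  (L := lax_B2 (lam i) (lam j) (cst (phi i)) (cst (phi j)) (cst u) (cst v))
  (W := [:: (1, 1); (0, 1); (0, -1); (-1, -1)])
  (pos := [:: (0, 1); (1, 2); (0, 2); (0, 3)]%N)).
- by [].
- by [].
- by vm_compute.
- case=> [|[|//]] _; rewrite /= -/u !br_self ?ji ?ui ?uj ?vi ?vj;
  by entries; rewrite ?mulr0z; ring.
- by [].
- by rewrite /=; entries; ring.
- rewrite /= !(rmorphD, rmorphN, rmorphMn, rmorph0) /= s_self s_lam aji.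
  rewrite s_phi (s_chain (erefl u) (erefl v) iv0 (br00 _)).
  rewrite (s_chain1 (erefl v) iv0) (s_fixed iv0) rmorph0 mulr0 addr0.
  rewrite (expM_rows (l2 := [::]) (E :=
      [:: [:: 1; x i]; [:: 0; 1]; [:: 0; 0; 1; - x i]; [:: 0; 0; 0; 1]])).
  + move: (x i) (lamE i) => z ->; rewrite -!mul_rows_mx; apply: rows_mx_eq.
    by rewrite /mul_rows /mkseq /=; entries; field; rewrite ?K2.
  + by [].
  + by vm_compute.
  + by rewrite /=; entries; rewrite ?mulr0z ?mulr1z ?mulrN1z; ring.
- rewrite /= !(rmorphD, rmorphN, rmorphMn, rmorph0) /= s_self s_lam aij.
  rewrite s_phi (s_chain1 ji) ?brN ?ju0 ?oppr0 // (s_fixed ju0) (s_fixed jv0).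
  rewrite rmorphN.
  rewrite (expM_rows (l2 := [::]) (E :=
      [:: [:: 1]; [:: 0; 1; x j]; [:: 0; 0; 1]; [:: 0; 0; 0; 1]])).
  + move: (x j) (lamE j) => z ->; rewrite -!mul_rows_mx; apply: rows_mx_eq.
    by rewrite /mul_rows /mkseq /=; entries; ring.
  + by [].
  + by vm_compute.
  + by rewrite /=; entries; rewrite ?mulr0z ?mulr1z; ring.
Qed.

(** ** Type G2 *)

Definition rho_G2 : seq (seq (seq int)) :=
  [:: [:: [:: 0; 1]; [::]; [:: 0; 0; 0; 2]; [:: 0; 0; 0; 0; 1]; [::];
          [:: 0; 0; 0; 0; 0; 0; 1]; [::]];
      [:: [::]; [:: 0; 0; 1]; [::]; [::]; [:: 0; 0; 0; 0; 0; 1]; [::]; [::]];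
      [:: [:: 0; 0; 1]; [:: 0; 0; 0; -2]; [::]; [:: 0; 0; 0; 0; 0; 1];
          [:: 0; 0; 0; 0; 0; 0; -1]; [::]; [::]];
      [:: [:: 0; 0; 0; -4]; [:: 0; 0; 0; 0; 2]; [:: 0; 0; 0; 0; 0; 2];
          [:: 0; 0; 0; 0; 0; 0; -2]; [::]; [::]; [::]];
      [:: [:: 0; 0; 0; 0; 6]; [::]; [:: 0; 0; 0; 0; 0; 0; -6]; [::]; [::];
          [::]; [::]];
      [:: [:: 0; 0; 0; 0; 0; -6]; [:: 0; 0; 0; 0; 0; 0; -6]; [::]; [::]; [::];
          [::]; [::]] ].

Definition str_G2 (t : nat) : seq (seq int) :=
  if t is 0 then
    [:: [::]; [:: 0; 0; -1]; [:: 0; 0; 0; -1]; [:: 0; 0; 0; 0; -1]]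
  else [:: [:: 0; 0; 1]; [::]; [::]; [::]; [:: 0; 0; 0; 0; 0; -1]].

Definition lax_G2 (F : pzRingType) (l1 l2 p1 p2 p12 p112 p1112 p11122 : F) :
    seq (seq F) :=
  [:: [:: l1 *+ 4 + l2 *+ 6];
      [:: p1 *+ 2; l1 *+ 2 + l2 *+ 6];
      [:: p12 *+ 2; p2 *+ 6; l1 *+ 2];
      [:: - p112; - (p12 *+ 2); p1 *+ 2; 0];
      [:: p1112; p112; 0; p1 *+ 4; - (l1 *+ 2)];
      [:: - p11122; 0; p112; p12 *+ 4; p2 *+ 6; - (l1 *+ 2) - l2 *+ 6];
      [:: 0; - p11122; - p1112; - (p112 *+ 2); - (p12 *+ 2); p1 *+ 2;
          - (l1 *+ 4) - l2 *+ 6] ].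

Lemma data_G2 : a i j = -3 -> a j i = -1 ->
  iter 4 (br (phi i)) (phi j) = 0 -> iter 2 (br (phi j)) (phi i) = 0 ->
  lax_data cst br phi lam s (pred2 i j) 6 7.
Proof.
move=> aij aji /=; set u := br (phi i) (phi j); set v := br (phi i) u.
set w := br (phi i) v => iw0.
have ji : br (phi j) (phi i) = - u by rewrite (poisson_skew brP).
rewrite ji brN => /eqP; rewrite oppr_eq0 => /eqP ju0.
have jv0 : br (phi j) v = 0.
  rewrite /v (br_ad brP) ju0 br00 addr0 ji (poisson_skew brP) brN br_self.
  by rewrite !oppr0.
set t := br (phi j) w.
(* The Jacobi identity gives t = - {u, v}, and then two values of
   {phi i, t} that are opposite to each other. *)
have tE : t = - br u v.
  by rewrite /t /w (br_ad brP) jv0 br00 addr0 ji (poisson_skew brP) brN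
             -(poisson_skew brP).
have it0 : br (phi i) t = 0.
  have e1 : br (phi i) t = br u w by rewrite /t (br_ad brP) iw0 br00 addr0.
  have e2 : br (phi i) t = - br u w.
    by rewrite tE brN (br_ad brP) br_self add0r.
  apply/eqP; have /eqP : br (phi i) t *+ 2 = 0 by rewrite mulr2n {1}e1 e2 subrr.
  by rewrite -mulr_natl mulf_eq0 (negbTE (A_0 1)).
have jt0 : br (phi j) t = 0.
  by rewrite tE brN (br_ad brP) ju0 jv0 br00 (poisson_skew brP) br00 oppr0 addr0 oppr0.
have ui : br u (phi i) = - v by rewrite (poisson_skew brP).
have vi : br v (phi i) = - w by rewrite (poisson_skew brP).
have wi : br w (phi i) = 0 by rewrite (poisson_skew brP) iw0 oppr0.
have ti : br t (phi i) = 0 by rewrite (poisson_skew brP) it0 oppr0.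
have uj : br u (phi j) = 0 by rewrite (poisson_skew brP) ju0 oppr0.
have vj : br v (phi j) = 0 by rewrite (poisson_skew brP) jv0 oppr0.
have wj : br w (phi j) = - t by rewrite (poisson_skew brP).
have tj : br t (phi j) = 0 by rewrite (poisson_skew brP) jt0 oppr0.
have K2 : 2%:R != 0 :> K by apply: K0.
have K6 : 6%:R != 0 :> K by apply: K0.
apply: (rank_two_data K0 ij lam_free (roots := [:: phi i; phi j; u; v; w; t])
  (N := str_G2) (R := rho_G2)
  (L := lax_G2 (lam i) (lam j) (cst (phi i)) (cst (phi j)) (cst u) (cst v)
          (cst w) (cst t))
  (W := [:: (4, 6); (2, 6); (2, 0); (0, 0); (-2, 0); (-2, -6); (-4, -6)])
  (pos := [:: (0, 1); (1, 2); (0, 2); (0, 3); (0, 4); (0, 5)]%N)).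
- by [].
- by [].
- by vm_compute.
- case=> [|[|//]] _; rewrite /= -/u !br_self ?ji ?ui ?uj ?vi ?vj ?wi ?wj ?ti ?tj;
  by entries; rewrite ?mulr0z; ring.
- by [].
- by rewrite /=; entries; ring.
- rewrite /= !(rmorphD, rmorphN, rmorphMn, rmorph0) /= s_self s_lam aji.
  rewrite s_phi (s_chain (erefl u) (erefl v) (erefl w) iw0).
  rewrite (s_chain (erefl v) (erefl w) iw0 (br00 _)) (s_chain1 (erefl w) iw0).
  rewrite (s_fixed iw0) (s_fixed it0) rmorph0 mulr0 addr0.
  rewrite (expM_rows (l2 := [:: [::]; [::]; [:: 0; 0; 0; 0; 2]]) (E :=
      [:: [:: 1; x i]; [:: 0; 1]; [:: 0; 0; 1; x i *+ 2; x i ^+ 2];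
          [:: 0; 0; 0; 1; x i]; [:: 0; 0; 0; 0; 1];
          [:: 0; 0; 0; 0; 0; 1; x i]; [:: 0; 0; 0; 0; 0; 0; 1]])).
  + move: (x i) (lamE i) => z ->; rewrite -!mul_rows_mx; apply: rows_mx_eq.
    by rewrite /mul_rows /mkseq /=; entries; field; rewrite ?K2 ?K6.
  + by [].
  + by vm_compute.
  + move: (x i) => z.
    by rewrite /=; entries; rewrite ?mulr0z ?mulr1z; field; rewrite ?K2.
- rewrite /= !(rmorphD, rmorphN, rmorphMn, rmorph0) /= s_self s_lam aij.
  rewrite s_phi (s_chain1 ji) ?brN ?ju0 ?oppr0 // (s_fixed ju0) (s_fixed jv0).
  rewrite (s_chain1 (erefl t) jt0) (s_fixed jt0) rmorphN.
  rewrite (expM_rows (l2 := [::]) (E :=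
      [:: [:: 1]; [:: 0; 1; x j]; [:: 0; 0; 1]; [:: 0; 0; 0; 1];
          [:: 0; 0; 0; 0; 1; x j]; [:: 0; 0; 0; 0; 0; 1];
          [:: 0; 0; 0; 0; 0; 0; 1]])).
  + move: (x j) (lamE j) => z ->; rewrite -!mul_rows_mx; apply: rows_mx_eq.
    by rewrite /mul_rows /mkseq /=; entries; ring.
  + by [].
  + by vm_compute.
  + by rewrite /=; entries; rewrite ?mulr0z ?mulr1z; ring.
Qed.
End RankTwo.

(** * Squares of the reflections *)

Section Involution.
Variables (A : idomainType) (K : fieldType) (cst : {rmorphism A -> K}).
Variables (e : A -> A) (x : K) (sigma : {rmorphism K -> K}).
Hypotheses (K0 : char0 K) (e0 : e 0 = 0).
Hypothesis e_nil : forall u, exists n, iter n e u = 0.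
Hypothesis sigma_exp : forall u n, iter n e u = 0 ->
  sigma (cst u) = expS cst e x n u.
Hypothesis sigma_x : sigma x = - x.

(** Applying sigma to the series exp (x e) u turns its coefficient x into - x,
    so that the square of sigma is exp (- x e) exp (x e) on u. *)
Lemma exp_involution u : sigma (sigma (cst u)) = cst u.
Proof.
have [p up] := e_nil u.
pose f j m := (- x) ^+ j * x ^+ m * cst (iter (m + j) e u).
have f0 j m : (p <= j)%N || (p <= m)%N -> f j m = 0.
  by move=> jm; rewrite /f (iter_eq0 e0 _ up) ?rmorph0 ?mulr0 //; lia.
transitivity (\sum_(j < p) \sum_(m < p) j`!%:R^-1 * m`!%:R^-1 * f j m).
  rewrite (sigma_exp up) rmorph_sum; apply: eq_bigr => j _.
  rewrite !rmorphM fmorphV rmorph_nat rmorphXn sigma_x.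
  have jp : iter p e (iter j e u) = 0.
    by rewrite -iterD; apply: (iter_eq0 e0 _ up); apply: leq_addr.
  rewrite (sigma_exp jp) mulr_sumr; apply: eq_bigr => m _.
  by rewrite /f -iterD; ring.
rewrite -(exponential_product K0 (leqnSn (p + p)) f0).
transitivity (\sum_(n < (p + p).+1)
    n`!%:R^-1 * ((x - x) ^+ n * cst (iter n e u))).
  apply: eq_bigr => n _; congr (_ * _).
  rewrite exprDn mulr_suml; apply: eq_bigr => j _.
  by rewrite /f subnK -1?ltnS // mulrnAl [x ^+ _ * _]mulrC.
rewrite big_ord_recl big1 => [|n _]; last by rewrite subrr expr0n mul0r mulr0.
by rewrite fact0 invr1 expr0 !mul1r addr0.
Qed.
End Involution.

(** * Action on the lambda's *)

Section LambdaAction.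
Variables (K : fieldType) (I : eqType) (s : I -> {rmorphism K -> K}).
Variables (lam : I -> K) (a : I -> I -> int).
Hypothesis s_lam : forall i j, s i (lam j) = lam j - lam i *~ a j i.
Hypothesis a_diag : forall i, a i i = 2.
Variables i j : I.

(** How s i \o s j changes the coordinates on lam i and lam j of an element
    of lam l + Z lam i + Z lam j. *)
Definition pair_step l (v : int * int) : int * int :=
  let y := - v.2 - a l j - a i j * v.1 in (- v.1 - a l i - a j i * y, y).

Lemma iter_lambda l m (v : int * int) :
  iter m (s i \o s j) (lam l + lam i *~ v.1 + lam j *~ v.2)
  = let w := iter m (pair_step l) v in lam l + lam i *~ w.1 + lam j *~ w.2.
Proof.
elim: m => //= m ->; set w := iter m _ v; rewrite /pair_step /=.
rewrite !(rmorphD, rmorphMz) /= !s_lam !a_diag.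
rewrite !(rmorphD, rmorphN, rmorphMz) !s_lam ?a_diag.
ring.
Qed.

Lemma alternating_fixes_lambda m :
  (forall l, iter m (pair_step l) (0, 0) = (0, 0)) ->
  forall l, iter m (s i \o s j) (lam l) = lam l.
Proof.
move=> h l; have := iter_lambda l m (0, 0).
by rewrite h /= !mulr0z !addr0.
Qed.
End LambdaAction.

(** * The Weyl group action *)

(** What the argument uses of the field of rational functions in the lambda's
    with coefficients in A0; [vanishing] stands for the maximal ideal of the
    local ring at lambda = 0. *)
Record lambda_field (I : eqType) (A0 : idomainType) (K : fieldType)
    (cst : {rmorphism A0 -> K}) (lam : I -> K) (vanishing : K -> Prop) :
    Prop := LambdaField {
  cst_inj : forall x, (cst x == 0) = (x == 0);
  lambda_field_ind : forall P : K -> Prop,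
    (forall x, P (cst x)) -> (forall i, P (lam i)) ->
    (forall f g, P f -> P g -> P (f + g)) ->
    (forall f g, P f -> P g -> P (f * g)) ->
    (forall f, P f -> P f^-1) -> forall f, P f;
  lambda_independent : forall i j (p q : int), i != j ->
    lam i *~ p + lam j *~ q = 0 -> p = 0 /\ q = 0;
  van0 : vanishing 0;
  van_lambda : forall i, vanishing (lam i);
  vanD : forall f g, vanishing f -> vanishing g -> vanishing (f + g);
  vanM : forall f g, vanishing f -> vanishing g -> vanishing (f * g);
  van_cstM : forall x f, vanishing f -> vanishing (cst x * f);
  van_div : forall f g x, x != 0 -> vanishing f -> vanishing (g - cst x) ->
    vanishing (f / g);
  van_der : exists D : K -> K, [/\ derivation_along id D,
    forall x, D (cst x) = 0 & forall f, vanishing f -> D f = 0 -> f = 0]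
}.

Section WeylAction.
Variables (k : fieldType) (I : eqType) (a : I -> I -> int).
Variables (A0 : idomainType) (c : {rmorphism k -> A0}).
Variables (br : A0 -> A0 -> A0) (phi : I -> A0).
Hypotheses (a_GCM : is_GCM a) (br_poisson : is_poisson c br).
Hypothesis phi_gen : forall x : A0, poisson_generated c br phi x.
Hypothesis phi_neq0 : forall i, phi i != 0.
Hypothesis phi_serre : forall i j, i != j ->
  iter (absz (- a i j + 1)) (br (phi i)) (phi j) = 0.
Variables (K : fieldType) (cst : {rmorphism A0 -> K}) (lam : I -> K).
Variable vanishing : K -> Prop.
Hypothesis K_field : lambda_field cst lam vanishing.
Variable brK : K -> K -> K.
Hypothesis brKP : is_poisson (cst \o c) brK.
Hypothesis brK_cst : forall x y, brK (cst x) (cst y) = cst (br x y).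
Hypothesis brK_lambda : forall i f, brK (lam i) f = 0.
Variable s : I -> {rmorphism K -> K}.
Hypothesis s_exp : forall i u n, iter n (br (phi i)) u = 0 ->
  s i (cst u) = expS cst (br (phi i)) (lam i / cst (phi i)) n u.
Hypothesis s_lambda : forall i j, s i (lam j) = lam j - lam i *~ a j i.
Hypothesis k0 : char0 k.

Local Notation word := (word_morph s).

Lemma char0_A : char0 A0.
Proof. by move=> n; rewrite -(rmorph_nat c) fmorph_eq0. Qed.

Lemma char0_K : char0 K.
Proof. by move=> n; rewrite -(rmorph_nat cst) (cst_inj K_field) char0_A. Qed.

Lemma cst_phi_neq0 i : cst (phi i) != 0.
Proof. by rewrite (cst_inj K_field). Qed.

(** The generators of A0 are killed by powers of ad phi_i by the Serre
    relations, and the derivation ad phi_i respects all the operations that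
    generate A0. *)
Lemma ad_nilpotent i u : exists n, iter n (br (phi i)) u = 0.
Proof.
have addr z := (br_derivationr br_poisson z).1.
have addl z := (br_derivationl br_poisson z).1.
have e0 := zmod0 (addr (phi i)).
elim: {u} (phi_gen u) => [j|t|x y _ [m xm] _ [n yn]|x y _ [m xm] _ [n yn]
    |x y _ [m xm] _ [n yn]].
- have [<-|ij] := eqVneq i j; last by exists (absz (- a i j + 1)); apply: phi_serre.
  by exists 1%N; apply: (br_self br_poisson char0_A).
- by exists 1%N; apply: (br_const br_poisson).
- exists (maxn m n); rewrite (zmodD (zmod_iter _ (addr (phi i)))).
  by rewrite (iter_eq0 e0 _ xm) ?(iter_eq0 e0 _ yn) ?addr0 ?leq_maxl ?leq_maxr.
- exists (m + n)%N; apply: (iter_leibniz_eq0 _ _ (addr (phi i)) _ xm yn).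
  + by move=> z v w; rewrite mulrBl.
  + by move=> z v w; rewrite mulrBr.
  + by move=> v w; rewrite (derM (br_derivationr br_poisson (phi i))).
- exists (m + n)%N; apply: (iter_leibniz_eq0 addl addr (addr (phi i)) _ xm yn).
  exact: (br_ad br_poisson).
Qed.

Let brK_derl (z : K) : derivation_along id (brK^~ z).
Proof. exact: (br_derivationl (c := cst \o c) brKP). Qed.
Let brK_derr (z : K) : derivation_along id (brK z).
Proof. exact: (br_derivationr (c := cst \o c) brKP). Qed.

Lemma lambda_central i f : brK f (lam i) = 0.
Proof. by rewrite (poisson_skew brKP) brK_lambda oppr0. Qed.

Lemma derivation_eq0 (t : {rmorphism K -> K}) (d : K -> K) :
  derivation_along t d -> (forall u, d (cst u) = 0) ->
  (forall i, d (lam i) = 0) -> forall f, d f = 0.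
Proof.
move=> dP dc dl; apply: (lambda_field_ind K_field) => // [f g df dg|f g df dg|f df].
- by rewrite (derD dP) df dg addr0.
- by rewrite (derM dP) df dg mulr0 mul0r addr0.
- by rewrite (derV dP) df mulr0.
Qed.

(** The difference of the two sides is a derivation along s i in each of f and
    g, so the claim only concerns A0 and the lambda's. *)
Lemma s_canonical i f g : s i (brK f g) = brK (s i f) (s i g).
Proof.
pose d1 g f := s i (brK f g) - brK (s i f) (s i g).
have d1P h : derivation_along (s i) (d1 h).
  split=> v w; rewrite /d1.
    by rewrite (derB (brK_derl h)) !rmorphB (derB (brK_derl _)) !opprD !opprK addrACA.
  rewrite (derM (brK_derl h)) !rmorphD !rmorphM (derM (brK_derl _)) /=.
  by rewrite opprD addrACA -mulrBl -mulrBr.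
have d2P h : derivation_along (s i) (d1^~ h).
  split=> v w; rewrite /d1.
    by rewrite (derB (brK_derr h)) !rmorphB (derB (brK_derr _)) !opprD !opprK addrACA.
  rewrite (derM (brK_derr h)) !rmorphD !rmorphM (derM (brK_derr _)) /=.
  by rewrite opprD addrACA -mulrBl -mulrBr.
have s_lambda_central h j : brK (s i (lam j)) h = 0.
  rewrite s_lambda (derB (brK_derl h)) (zmodMz (brK_derl h).1).
  by rewrite !brK_lambda mul0rz subr0.
have d1_lambda h j : d1 h (lam j) = 0.
  by rewrite /d1 brK_lambda rmorph0 s_lambda_central subrr.
have d2_lambda h j : d1 (lam j) h = 0.
  rewrite /d1 lambda_central rmorph0 (poisson_skew brKP) s_lambda_central.
  by rewrite oppr0 subrr.
have d1_cst u v : d1 (cst v) (cst u) = 0.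
  rewrite /d1 brK_cst.
  apply/eqP; rewrite subr_eq0; apply/eqP.
  exact: (exp_canonical br_poisson brKP brK_cst char0_K (brK_lambda i)
    (cst_phi_neq0 i) (ad_nilpotent i) (sigma := s i \o cst) (@s_exp i)).
have d0 : d1 g f = 0.
  apply: (derivation_eq0 (d2P f)) => // u.
  by apply: (derivation_eq0 (d1P (cst u))).
by apply/eqP; rewrite -subr_eq0 -/(d1 g f) d0.
Qed.

Lemma morph_eq_id (t : {rmorphism K -> K}) :
  (forall u, t (cst u) = cst u) -> (forall i, t (lam i) = lam i) -> t =1 id.
Proof.
move=> tc tl; apply: (lambda_field_ind K_field) => // [f g df dg|f g df dg|f df].
- by rewrite rmorphD df dg.
- by rewrite rmorphM df dg.
- by rewrite fmorphV df.
Qed.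

Let e0 i : br (phi i) 0 = 0. Proof. exact: der0 (br_derivationr br_poisson _). Qed.

Lemma s_involutive i : s i \o s i =1 id.
Proof.
have phi_phi : br (phi i) (phi i) = 0 by apply: (br_self br_poisson char0_A).
have s_phi : s i (cst (phi i)) = cst (phi i).
  have h : iter 1 (br (phi i)) (phi i) = 0 by [].
  by rewrite (s_exp h) /expS big_ord1 fact0 invr1 expr0 !mul1r.
have s_self : s i (lam i) = - lam i.
  by rewrite s_lambda (GCM_diag a_GCM); ring.
have s_x : s i (lam i / cst (phi i)) = - (lam i / cst (phi i)).
  by rewrite rmorphM fmorphV s_phi s_self mulNr.
apply: (morph_eq_id (t := (s i \o s i)%FUN)) => [u|j] /=.
  exact: (exp_involution char0_K (e0 i) (ad_nilpotent i) (@s_exp i) s_x).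
rewrite !s_lambda rmorphB rmorphMz s_self s_lambda; ring.
Qed.

(** The images of lam i / phi i vanish at the origin, so that there only the
    first term of each exponential series survives. *)
Lemma word_vanishing u :
  (forall i, vanishing (word u (lam i))) /\
  (forall v, vanishing (word u (cst v) - cst v)).
Proof.
elim/last_ind: u => [|u i [IHl IHc]].
  split=> [i | v] /=; first exact: (van_lambda K_field).
  by rewrite subrr; apply: (van0 K_field).
have van_int z f : vanishing f -> vanishing (f *~ z).
  by move=> vf; rewrite -mulrzr mulrC -(rmorph_int cst); apply: (van_cstM K_field).
split=> [j | v].
  rewrite word_morph_rcons s_lambda rmorphB rmorphMz -mulrNz.
  by apply: (vanD K_field) => //; apply: van_int.
set y := word u (lam i / cst (phi i)).
have vy : vanishing y.
  rewrite /y rmorphM fmorphV; exact: (van_div K_field (phi_neq0 i)).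
have vy_pow n w : vanishing (y ^+ n.+1 * word u (cst w)).
  have -> : y ^+ n.+1 * word u (cst w)
      = y ^+ n.+1 * (word u (cst w) - cst w) + cst w * y ^+ n.+1 by ring.
  have vyn : vanishing (y ^+ n.+1).
    by elim: n => [|n IH]; rewrite ?expr1 // exprS; apply: (vanM K_field).
  by apply: (vanD K_field); [apply: (vanM K_field) | apply: (van_cstM K_field)].
have [n0 n0v] := ad_nilpotent i v.
have nv : iter n0.+1 (br (phi i)) v = 0 by rewrite iterS n0v e0.
rewrite word_morph_rcons (s_exp nv) rmorph_sum big_ord_recl /=.
rewrite fact0 invr1 expr0 !mul1r addrAC; apply: (vanD K_field) => //.
elim/big_ind: _ => [|f g vf vg|m _].
- exact: (van0 K_field).
- exact: (vanD K_field).
- rewrite !rmorphM fmorphV rmorph_nat rmorphXn -/y -mulrA mulrC.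
  apply: (van_div K_field (x := (bump 0 m)`!%:R)).
  + by rewrite -(cst_inj K_field) rmorph_nat (fact_neq0 char0_K).
  + exact: vy_pow.
  + by rewrite rmorph_nat subrr; apply: (van0 K_field).
Qed.

(** On A0 the difference of the word and the identity vanishes at the origin
    and is killed by the derivation D of van_der. *)
Lemma alternating_word_id i j m d n
    (L : lax_data cst br phi lam s (pred2 i j) d n) :
  (forall l, iter m (s i \o s j) (lam l) = lam l) -> iter m (s i \o s j) =1 id.
Proof.
set u := flatten (nseq m [:: i; j]) => fix_lam.
have uE f : word u f = iter m (s i \o s j) f by apply: word_morph_alternating.
have lu : all (pred2 i j) u.
  by rewrite /u; elim: m {u uE fix_lam} => //= m ->; rewrite !eqxx orbT.
have [D [DP D_cst D_inj]] := van_der K_field.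
have Du := word_constant br_poisson char0_K ad_nilpotent s_exp DP D_cst L lu.
move=> f; rewrite -uE; move: f; apply: morph_eq_id => [v | l]; last first.
  by rewrite uE.
apply/eqP; rewrite -subr_eq0; apply/eqP; apply: D_inj.
  exact: (word_vanishing u).2.
by rewrite (derB DP) D_cst Du ?subr0 // => l _; rewrite uE.
Qed.

Lemma alternating_swap i j m :
  iter m (s j \o s i) =1 id -> iter m (s i \o s j) =1 id.
Proof.
move=> h f; have ss g : s i (s i g) = g := s_involutive i g.
have conj n g : iter n (s i \o s j) (s i g) = s i (iter n (s j \o s i) g).
  by elim: n => //= n ->.
by rewrite -{1}[f]ss conj h.
Qed.

(** If a i j * a j i is at most 3, then one of the two entries is 0 or -1. With
    a j i this entry, the product is - a i j unless both entries are 0. *)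
Lemma alternating_id i j m : i != j -> a j i = -1 \/ a j i = 0 ->
  coxeter_order a i j = Some m -> iter m (s i \o s j) =1 id.
Proof.
move=> ij aji_cases; have ji : j != i by rewrite eq_sym.
have free p q := @lambda_independent _ _ _ _ _ _ K_field _ _ p q ij.
have serre_ij := phi_serre ij; have serre_ji := phi_serre ji.
have fixl := alternating_fixes_lambda s_lambda (GCM_diag a_GCM) (i := i) (j := j).
have aij_le0 := GCM_offdiag a_GCM ij.
case: aji_cases => aji; last first.
  have aij : a i j = 0 by apply/(GCM_zero a_GCM).
  rewrite /coxeter_order aij mul0r => -[<-].
  move: serre_ij; rewrite aij /= => b0.
  apply: (alternating_word_id (data_A1A1 br_poisson char0_A char0_K s_exp s_lambda
    (GCM_diag a_GCM) cst_phi_neq0 ij free aij aji b0)).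
  apply: fixl => l; rewrite /pair_step /= aij aji.
  by congr (_, _); ring.
have [n aij] : exists n : nat, a i j = - n%:Z.
  by exists (absz (a i j)); move: aij_le0; lia.
have n0 : n != 0%N.
  apply/eqP => n0; move: aij; rewrite n0 oppr0 => /(GCM_zero a_GCM).
  by rewrite aji.
rewrite /coxeter_order (_ : absz (a i j * a j i) = n); last first.
  by rewrite aij aji mulrN1 opprK.
move: serre_ij serre_ji; rewrite aij aji opprK.
case: n aij n0 => [|[|[|[|n]]]] // aij _ /= b1 b2 [<-].
- apply: (alternating_word_id (data_A2 br_poisson char0_A char0_K s_exp s_lambda
    (GCM_diag a_GCM) cst_phi_neq0 ij free aij aji b1 b2)).
  apply: fixl => l; rewrite /pair_step /= aij aji.
  by congr (_, _); ring.
- apply: (alternating_word_id (data_B2 br_poisson char0_A char0_K s_exp s_lambda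
    (GCM_diag a_GCM) cst_phi_neq0 ij free aij aji b1 b2)).
  apply: fixl => l; rewrite /pair_step /= aij aji.
  by congr (_, _); ring.
- apply: (alternating_word_id (data_G2 br_poisson char0_A char0_K s_exp s_lambda
    (GCM_diag a_GCM) cst_phi_neq0 ij free aij aji b1 b2)).
  apply: fixl => l; rewrite /pair_step /= aij aji.
  by congr (_, _); ring.
Qed.

Lemma coxeter_relation i j m : i != j -> coxeter_order a i j = Some m ->
  iter m (s i \o s j) =1 id.
Proof.
move=> ij cox; have ji : j != i by rewrite eq_sym.
have cox' : coxeter_order a j i = Some m by rewrite /coxeter_order mulrC.
have small h l : h != l -> a l h = -1 \/ a l h = 0 \/ a l h <= - 2%:Z.
  move=> hl; have := GCM_offdiag a_GCM (i := l) (j := h).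
  by rewrite eq_sym => /(_ hl); lia.
case: (small _ _ ij) => [aji|[aji|aji]].
- by apply: alternating_id cox => //; left.
- by apply: alternating_id cox => //; right.
case: (small _ _ ji) => [aij|[aij|aij]].
- by apply/alternating_swap/(alternating_id ji _ cox'); left.
- by apply/alternating_swap/(alternating_id ji _ cox'); right.
move: cox; rewrite /coxeter_order.
case e : (absz _) => [|[|[|[|n]]]] //; nia.
Qed.

Lemma word_canonical u : canonical_transformation (cst \o c) brK (word_act s u).
Proof.
split.
- split; first by move=> f g; rewrite -!word_morphE rmorphB.
  by split=> [|f g]; rewrite -!word_morphE ?rmorph1 ?rmorphM.
- move=> t; elim: u => //= i u ->.
  have h : iter 1 (br (phi i)) (c t) = 0 by apply: (br_const br_poisson).
  by rewrite (s_exp h) /expS big_ord1 fact0 invr1 expr0 !mul1r.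
- by move=> f g; elim: u => //= i u ->; rewrite s_canonical.
Qed.

Lemma word_act_cat u v f : word_act s (u ++ v) f = word_act s u (word_act s v f).
Proof. by rewrite -!word_morphE word_morph_cat. Qed.

Lemma weyl_action u v : weyl_eq a u v -> word_act s u =1 word_act s v.
Proof.
elim=> {u v} [u f|u v _ IH f|u v w _ uv _ vw f|u u' v v' _ uu _ vv f|i f
    |i j m ij cox f] //.
- by rewrite uv vw.
- by rewrite !word_act_cat uu vv.
- exact: s_involutive.
- by rewrite -word_morphE word_morph_alternating coxeter_relation.
Qed.
End WeylAction.

Lemma rational_functions_lambda_field (I : choiceType) (A0 : idomainType) :
  char0 A0 -> lambda_field (@cst I A0) (@lambda I A0) (@vanishing I A0).
Proof.
move=> A0_0; split.
- exact: cst_eq0.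
- exact: field_generated.
- by move=> i j p q; apply: lambda_free.
- exact: vanishing0.
- exact: vanishing_lambda.
- exact: vanishingD.
- exact: vanishingM.
- exact: vanishing_cstM.
- exact: vanishing_div.
- exact: separating_derivation.
Qed.

Unset Implicit Arguments.

Theorem theorem1p1 (R : realType) (I : choiceType) (a : I -> I -> int)
    (A0 : idomainType) (c : {rmorphism R[i]%C -> A0})
    (br : A0 -> A0 -> A0) (phi : I -> A0)
    (a_GCM : is_GCM a)
    (br_poisson : is_poisson c br)
    (phi_gen : forall x : A0, poisson_generated c br phi x)
    (phi_neq0 : forall i, phi i != 0)
    (phi_serre : forall i j, i != j ->
      iter (absz (- a i j + 1)) (br (phi i)) (phi j) = 0)
    (brK : lambda_fractions A0 I -> lambda_fractions A0 I ->
      lambda_fractions A0 I)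
    (brK_ext : is_poisson_extension c br brK)
    (s : I -> {rmorphism lambda_fractions A0 I -> lambda_fractions A0 I})
    (s_def : forall i, is_weyl_automorphism br a phi i (s i)) :
  [/\ (forall u, canonical_transformation (@cst I A0 \o c) brK (word_act s u)) /\
      (forall u v, weyl_eq a u v -> word_act s u =1 word_act s v),
      forall i f g, s i (brK f g) = brK (s i f) (s i g),
      forall i, s i \o s i =1 id
    & forall i j m, i != j -> coxeter_order a i j = Some m ->
        iter m (s i \o s j) =1 id].
Proof.
have C0 : char0 R[i]%C by move=> n; rewrite Num.Theory.pnatr_eq0.
have A0_0 := char0_A c C0.
have K_field := rational_functions_lambda_field I A0_0.
have brKP := extension_poisson brK_ext.
have brK_cst := extension_cst brK_ext.
have brK_lambda := extension_lambda brK_ext.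
have s_exp i := weyl_cst (s_def i).
have s_lambda i := weyl_lambda (s_def i).
split.
- split=> [u | u v].
    exact: (word_canonical br_poisson phi_gen phi_neq0 phi_serre K_field
      brKP brK_cst brK_lambda s_exp s_lambda C0).
  exact: (weyl_action a_GCM br_poisson phi_gen phi_neq0 phi_serre K_field
    s_exp s_lambda C0).
- exact: (s_canonical br_poisson phi_gen phi_neq0 phi_serre K_field
    brKP brK_cst brK_lambda s_exp s_lambda C0).
- exact: (s_involutive a_GCM br_poisson phi_gen phi_serre K_field
    s_exp s_lambda C0).
- exact: (coxeter_relation a_GCM br_poisson phi_gen phi_neq0 phi_serre K_field
    s_exp s_lambda C0).
Qed.
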